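(* There is an algorithm which, given an $n$-vertex graph $G=(V,E)$ and a value $r\ge 1$, produces an $r$-approximation for \textsc{Max Min FVS} in $G$ (that is, a minimal feedback vertex set of $G$ of size at least $\mathrm{mmfvs}(G)/r$) in time $n^{O(n/r^{3/2})}$.
   Context: All graphs are finite, simple and loopless. A feedback vertex set (fvs) of $G=(V,E)$ is a set $S\subseteq V$ such that the subgraph induced by $V\setminus S$ is a forest; it is minimal if no proper subset of it is an fvs. $\mathrm{mmfvs}(G)$ is the maximum size of a minimal fvs of $G$. \textsc{Max Min FVS}: given a graph $G$, find a minimal fvs of $G$ of maximum size.
   Formalization: The time bound is max(n,2)^(c·max(1, n/r^{3/2})), read as polynomial when r exceeds n^{2/3} or n ≤ 1, since the literal bound then falls below the steps any algorithm needs; r is a rational number ≥ 1 (a real r follows by applying it to its floor). *)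

(* Defs.v *)
From mathcomp Require Import all_boot all_order all_algebra.
From mathcomp Require Import boolp reals exp.

Set Implicit Arguments.
Unset Strict Implicit.
Unset Printing Implicit Defensive.

Import Order.TTheory GRing.Theory Num.Theory.

Record sgraph (T : finType) := SGraph {
  adj :> rel T;
  adj_sym : symmetric adj;
  adj_irr : irreflexive adj
}.

Section Graphs.
Variable T : finType.
Implicit Types (G : sgraph T) (A S : {set T}).

Definition induced_adj G A : rel {x : T | x \in A} := relpre val (adj G).

Fact induced_sym G A : symmetric (@induced_adj G A).
Proof. by move=> x y; apply: adj_sym. Qed.

Fact induced_irr G A : irreflexive (@induced_adj G A).
Proof. by move=> x; apply: adj_irr. Qed.

Definition induced G A : sgraph {x : T | x \in A} :=
  SGraph (@induced_sym G A) (@induced_irr G A).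

(* The size condition is needed because [ucycle] also accepts the empty
   sequence and, for every edge xy, the closed walk [:: x; y]. *)
Definition forest G : Prop := forall c : seq T, 2 < size c -> ~ ucycle G c.

End Graphs.

Section FeedbackVertexSets.
Variables (T : finType) (G : sgraph T).

Definition fvs (S : {set T}) : Prop := forest (induced G (~: S)).

Definition minimal_fvs (S : {set T}) : Prop :=
  fvs S /\ forall S' : {set T}, S' \proper S -> ~ fvs S'.

(* The maximum is over a nonempty family: [set: T] is an fvs, hence a minimal
   one exists. *)
Definition mmfvs : nat := \max_(S : {set T} | `[< minimal_fvs S >]) #|S|.

End FeedbackVertexSets.

(* Machine model: a random access machine with structured control flow, whose
   memory is a family of arrays of natural numbers, [m a k] being cell k of
   array a (array names are literal in programs, so a program uses finitely many
   arrays; indices are computed, i.e. addressing is indirect; a scalar variable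
   is cell 0 of an array).  Every operation has unit cost.  Multiplication is
   deliberately not primitive: unit-cost RAMs with addition and subtraction only
   are polynomially equivalent to Turing machines, which fails if multiplication
   also has unit cost. *)
Definition memory := nat -> nat -> nat.

Definition upd (m : memory) (a k v : nat) : memory :=
  fun b j => if (b == a) && (j == k) then v else m b j.

Inductive expr :=
| ECst of nat
| EGet of nat & expr
| EAdd of expr & expr
| ESub of expr & expr.

Fixpoint eval (m : memory) (x : expr) : nat :=
  match x with
  | ECst k => k
  | EGet a y => m a (eval m y)
  | EAdd y z => eval m y + eval m z
  | ESub y z => eval m y - eval m z
  end.

Fixpoint cost (x : expr) : nat :=
  match x with
  | ECst _ => 1
  | EGet _ y => (cost y).+1
  | EAdd y z | ESub y z => (cost y + cost z).+1
  end.

Inductive com :=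
| CSkip
| CPut of nat & expr & expr
| CSeq of com & com
| CIf of expr & com & com
| CWhile of expr & com.

(* [exec p m t m']: started in memory m, the program p halts after t steps in
   memory m'.  Nonzero values count as true.  The relation is deterministic. *)
Inductive exec : com -> memory -> nat -> memory -> Prop :=
| ExecSkip m : exec CSkip m 1 m
| ExecPut m a x y :
    exec (CPut a x y) m (cost x + cost y).+1 (upd m a (eval m x) (eval m y))
| ExecSeq p q m m1 m2 t1 t2 :
    exec p m t1 m1 -> exec q m1 t2 m2 -> exec (CSeq p q) m (t1 + t2).+1 m2
| ExecIfTrue x p q m t m1 :
    eval m x != 0 -> exec p m t m1 -> exec (CIf x p q) m (cost x + t).+1 m1
| ExecIfFalse x p q m t m1 :
    eval m x = 0 -> exec q m t m1 -> exec (CIf x p q) m (cost x + t).+1 m1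
| ExecWhileStop x p m :
    eval m x = 0 -> exec (CWhile x p) m (cost x).+1 m
| ExecWhileStep x p m t1 m1 t2 m2 :
    eval m x != 0 -> exec p m t1 m1 -> exec (CWhile x p) m1 t2 m2 ->
    exec (CWhile x p) m (cost x + t1 + t2).+1 m2.

(* Initial memory: array 0 holds n and the numerator and denominator of the
   rational r (only used for r >= 1, so the absolute value is harmless); array 1
   holds the adjacency matrix of G in row-major order; all other cells are 0. *)
Definition input (n : nat) (G : sgraph 'I_n) (r : rat) : memory :=
  fun a k => match a with
  | 0 => nth 0 [:: n; absz (numq r); absz (denq r)] k
  | 1 => [exists i : 'I_n, exists j : 'I_n, (k == i * n + j) && G i j]
  | _ => 0
  end.

(* The final content of array 2, read as a characteristic vector. *)
Definition output (n : nat) (m : memory) : {set 'I_n} :=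
  [set i : 'I_n | m 2 i != 0].

Local Open Scope ring_scope.

(* n^{c * n / r^{3/2}}, where, as usual for such bounds, base and exponent are
   made nondegenerate: for r > n^{2/3} the quotient n / r^{3/2} drops below 1
   (and tends to 0), where the bound stands for "polynomial in n"; and n <= 1
   would give base 0 or 1, hence at most 1 step. *)
Definition time_bound (R : realType) (c : R) (n : nat) (r : R) : R :=
  (maxn n 2)%:R `^ (c * Num.max 1 (n%:R / r `^ (3 / 2))).

(* Main.v *)
Require Import Defs.
From mathcomp Require Import all_boot all_order all_algebra.
From mathcomp Require Import boolp reals exp.
From mathcomp Require Import zify ring lra.

(* Complements of minimal feedback vertex sets are the maximal acyclic sets.
   Let F be a greedily built one and S0 its complement.  If |S0| >= n/r we are
   done.  Otherwise cut S0 into q ~ sqrt(r/7) parts of size h ~ n/r^{3/2}.  Every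
   vertex of F in an optimal solution S lies on a cycle of its own that leaves F
   on both sides through the complement of S, hence is charged to one of q^2
   pairs of parts.  For one pair, let U be the vertices of the two parts outside
   S; a closure argument enlarges U inside the complement of S to a set D with
   |D| <= 2|U| such that every other vertex of F in that complement has at most
   one neighbour in D.  Given D, let A be the set of vertices of F \ D with two
   neighbours in D, and L that of those with exactly one; the number charged to
   the pair is at most |A| + |L| minus the number of trees of F \ (D u A) meeting
   L.  Rooting these trees at vertices of L and 2-colouring them so that the
   colour changes exactly when one descends to a vertex of L, D together with
   one colour class is acyclic, and each vertex of L of the other colour that is
   not a root, as well as each vertex of A, has two neighbours leading to D.
   Adding such vertices merges components meeting D, so a maximal acyclic
   superset contains at most |D| of them, and one of the two colours gives about
   half of the bound.  The algorithm enumerates all D of size at most 4h,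
   encoded as numbers below (n+1)^{4h}. *)

(** Guessing all of S0, of size up to n/r, would cost n^{O(n/r)}. Guessing only the two parts of one
    pair saves a factor sqrt(r) in the exponent, and summing over the q^2 pairs costs a factor q^2
    in the ratio; hence q is of order sqrt(r). The closure of U to D is needed because otherwise the
    paths from a charged vertex to U might run through A, outside the forest F \ (D u A) whose trees
    are counted. After closure they stay in that forest until they enter D. Every count rests on one
    principle: when a vertex with two neighbours in components meeting a fixed set U joins an
    acyclic set and keeps it acyclic, two such components merge, so this happens at most |U| times.
    It bounds the closure, the charged vertices, and the vertices that a maximal acyclic superset
    can absorb. With V the size of the output, the two colours together give 2|A| + |L| - trees <=
    2V + 2|D|. As |D| <= 2|U| and U is part of S0, of size at most V, a pair is charged at most 6V.
    No guess has to be recognised as right: the inequality holds for every acyclic D tried, with the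
    final V, because the output is the best set met. *)

Set Implicit Arguments.
Unset Strict Implicit.
Unset Printing Implicit Defensive.

(** * Programs with bounded loops *)

(* [PFor i b p] runs p with i = 0, 1, ... below cell 0 of array b.  When the body
   writes neither i nor b, its meaning is a total function and its running time
   is bounded syntactically. *)
Inductive prog :=
| PSkip
| PPut of nat & expr & expr
| PSeq of prog & prog
| PIf of expr & prog & prog
| PFor of nat & nat & prog.

Definition varE (a : nat) : expr := EGet a (ECst 0).

Fixpoint compile (p : prog) : com :=
  match p with
  | PSkip => CSkip
  | PPut a x y => CPut a x y
  | PSeq p q => CSeq (compile p) (compile q)
  | PIf x p q => CIf x (compile p) (compile q)
  | PFor i b p =>
    CSeq (CPut i (ECst 0) (ECst 0))
      (CWhile (ESub (varE b) (varE i))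
        (CSeq (compile p) (CPut i (ECst 0) (EAdd (varE i) (ECst 1)))))
  end.

(** The number of iterations is read once, at entry. The compiled loop tests the bound and the
    counter again each time, so the two agree only when the body writes neither, which is what
    [well_formed] checks. *)
Fixpoint den (p : prog) (m : memory) : memory :=
  match p with
  | PSkip => m
  | PPut a x y => upd m a (eval m x) (eval m y)
  | PSeq p q => den q (den p m)
  | PIf x p q => if eval m x != 0 then den p m else den q m
  | PFor i b p =>
    iteri (m b 0) (fun k m' => upd (den p m') i 0 k.+1) (upd m i 0 0)
  end.

Fixpoint writes (p : prog) : seq nat :=
  match p with
  | PSkip => [::]
  | PPut a _ _ => [:: a]
  | PSeq p q | PIf _ p q => writes p ++ writes q
  | PFor i _ p => i :: writes p
  end.

Fixpoint bounds (p : prog) : seq nat :=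
  match p with
  | PSkip | PPut _ _ _ => [::]
  | PSeq p q | PIf _ p q => bounds p ++ bounds q
  | PFor _ b p => b :: bounds p
  end.

Fixpoint well_formed (p : prog) : bool :=
  match p with
  | PSkip | PPut _ _ _ => true
  | PSeq p q | PIf _ p q => well_formed p && well_formed q
  | PFor i b p => [&& i \notin writes p, b \notin writes p, b != i & well_formed p]
  end.

(** [B] stands for a common bound on all loop lengths. A conditional is charged for both branches;
    the 20 covers test, increment and set-up of the counter. *)
Fixpoint time (p : prog) (B : nat) : nat :=
  match p with
  | PSkip => 1
  | PPut _ x y => (cost x + cost y).+1
  | PSeq p q => (time p B + time q B).+1
  | PIf x p q => (cost x + (time p B + time q B)).+1
  | PFor _ _ p => B.+1 * (time p B + 20)
  end.

Lemma den_frame p m a : a \notin writes p -> den p m a = m a.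
Proof.
have updN m0 i k v : a != i -> upd m0 i k v a = m0 a.
  by move=> ai; apply: funext => j; rewrite /upd (negbTE ai).
elim: p m => [|b x y|p IHp q IHq|x p IHp q IHq|i b p IHp] m //=.
- by rewrite inE => /updN.
- by rewrite mem_cat negb_or => /andP[/IHp pE /IHq ->].
- by rewrite mem_cat negb_or => /andP[/IHp pE /IHq qE]; case: ifP.
- rewrite inE negb_or => /andP[ai /IHp pE].
  by elim: (m b 0) => [|k IHk] /=; rewrite updN // pE.
Qed.

Lemma for_prefix i b p m k : i \notin writes p -> b \notin writes p -> b != i ->
  let m' := iteri k (fun k m' => upd (den p m') i 0 k.+1) (upd m i 0 0) in
  m' i 0 = k /\ m' b 0 = m b 0.
Proof.
move=> ip bp bi; case: k => [|k] /=; rewrite /upd !eqxx (negbTE bi) //=.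
split=> //; rewrite (den_frame _ bp).
elim: k => [|k IHk] /=; first by rewrite (negbTE bi).
by rewrite (negbTE bi) (den_frame _ bp).
Qed.

(** The bounds are inspected in the initial memory only, which suffices since [p] never writes them.
    A bound must therefore be computed before the program that uses it starts. *)
Lemma exec_compile p m B : well_formed p ->
  {in bounds p, forall b, b \notin writes p /\ m b 0 <= B} ->
  exists2 t, exec (compile p) m t (den p m) & t <= time p B.
Proof.
elim: p m => [|a x y|p IHp q IHq|x p IHp q IHq|i b p IHp] m /=.
- by move=> _ _; exists 1 => //; constructor.
- by move=> _ _; exists (cost x + cost y).+1 => //; constructor.
- move=> /andP[wp wq] Hb.
  have [|t1 e1 l1] := IHp m wp.
    move=> b bp; have [] := Hb b; first by rewrite mem_cat bp.
    by rewrite mem_cat negb_or => /andP[].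
  have [|t2 e2 l2] := IHq (den p m) wq.
    move=> b bq; have [] := Hb b; first by rewrite mem_cat bq orbT.
    by rewrite mem_cat negb_or => /andP[? ?]; rewrite (den_frame m).
  by exists (t1 + t2).+1; [apply: ExecSeq e1 e2 | rewrite ltnS leq_add].
- move=> /andP[wp wq] Hb; case: ifPn => [x1|/negPn/eqP x0].
    have [|t e l] := IHp m wp.
      move=> b bp; have [] := Hb b; first by rewrite mem_cat bp.
      by rewrite mem_cat negb_or => /andP[].
    exists (cost x + t).+1; first exact: ExecIfTrue.
    by rewrite ltnS leq_add2l (leq_trans l) ?leq_addr.
  have [|t e l] := IHq m wq.
    move=> b bp; have [] := Hb b; first by rewrite mem_cat bp orbT.
    by rewrite mem_cat negb_or => /andP[].
  exists (cost x + t).+1; first exact: ExecIfFalse.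
  by rewrite ltnS leq_add2l (leq_trans l) ?leq_addl.
- move=> /and4P[ip bp bi wp] Hb.
  set f := fun k m' => upd (den p m') i 0 k.+1.
  set m0 := upd m i 0 0.
  have [_ mB] := Hb b (mem_head _ _).
  (* [k] iterations are done and [r] remain. Besides the body, an iteration costs 13: 5 for the
     test, 6 for the increment, 2 for sequencing. *)
  have loop r k : r + k = m b 0 -> exists2 t,
      exec (CWhile (ESub (varE b) (varE i))
        (CSeq (compile p) (CPut i (ECst 0) (EAdd (varE i) (ECst 1)))))
        (iteri k f m0) t (iteri (m b 0) f m0)
      & t <= r * (time p B + 15) + 10.
    elim: r k => [|r IHr] k rk.
      exists 6 => //; rewrite -rk; apply: (@ExecWhileStop (ESub _ _)) => /=.
      by have [-> ->] := for_prefix m k ip bp bi; rewrite -rk subnn.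
    have [|t e l] := IHp (iteri k f m0) wp.
      move=> b' b'p; have [|nb mb'] := Hb b'; first by rewrite inE b'p orbT.
      move: nb; rewrite inE negb_or => /andP[b'i b'np]; split=> //.
      by have [_ ->] := for_prefix m k ip b'np b'i.
    have [|t2 e2 l2] := IHr k.+1; first by rewrite addnS -addSn.
    have [k1 k2] := for_prefix m k ip bp bi.
    exists (5 + (t + 6).+1 + t2).+1.
      apply: (@ExecWhileStep (ESub _ _)) e2.
        by rewrite /= k1 k2 -rk; lia.
      apply: ExecSeq e _.
      have -> : iteri k.+1 f m0
          = upd (den p (iteri k f m0)) i (eval (den p (iteri k f m0)) (ECst 0))
             (eval (den p (iteri k f m0)) (EAdd (varE i) (ECst 1))).
        by rewrite /= (den_frame _ ip) k1 addn1.
      exact: (@ExecPut _ i (ECst 0) (EAdd (varE i) (ECst 1))).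
    by rewrite mulSn; lia.
  have [|t e l] := loop (m b 0) 0; first by rewrite addn0.
  exists (3 + t).+1; first by apply: ExecSeq e; exact: (@ExecPut m i (ECst 0) (ECst 0)).
  have : m b 0 * (time p B + 15) <= B * (time p B + 15) by rewrite leq_mul2r mB orbT.
  rewrite mulSn !mulnDr; lia.
Qed.

(** By induction on [p]: as the base is at least 2, a sum of two powers is absorbed by one more
    factor. *)
Lemma time_poly p : exists c, forall B, time p B <= (B + 2) ^ c.
Proof.
have mono B c d : c <= d -> (B + 2) ^ c <= (B + 2) ^ d by move=> cd; rewrite leq_pexp2l //; lia.
have cst k : exists c, forall B, k <= (B + 2) ^ c.
  exists k => B; apply: (leq_trans (ltnW (ltn_expl k (isT : 1 < 2)))).
  by case: k => // k; rewrite leq_exp2r //; lia.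
have sum f g : (exists c, forall B, f B <= (B + 2) ^ c) ->
    (exists c, forall B, g B <= (B + 2) ^ c) ->
    exists c, forall B, f B + g B <= (B + 2) ^ c.
  move=> [c Hc] [d Hd]; exists (maxn c d).+1 => B; rewrite expnS.
  have := leq_trans (Hc B) (mono B _ _ (leq_maxl c d)).
  have := leq_trans (Hd B) (mono B _ _ (leq_maxr c d)).
  set e := (_ ^ _) => h1 h2; rewrite mulnDl; lia.
have suc f : (exists c, forall B, f B <= (B + 2) ^ c) ->
    exists c, forall B, (f B).+1 <= (B + 2) ^ c.
  by move=> /sum/(_ (cst 1))[c Hc]; exists c => B; rewrite -addn1.
elim: p => [|a x y|p IHp q IHq|x p IHp q IHq|i b p IHp] /=.
- exact: cst.
- exact: cst.
- exact: (suc (fun B => time p B + time q B) (sum _ _ IHp IHq)).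
- exact: (suc (fun B => cost x + (time p B + time q B))
    (sum _ _ (cst (cost x)) (sum _ _ IHp IHq))).
- have [c Hc] := sum _ _ IHp (cst 20).
  by exists c.+1 => B; rewrite expnS leq_mul //; lia.
Qed.

(** The invariant rule for loops. Its frame hypothesis lets a body be analysed with every array that
    the loop does not write as it was at entry. *)
Lemma den_for_ind i b p m (I : nat -> memory -> Prop) :
  i \notin writes p -> I 0 (upd m i 0 0) ->
  (forall k m', k < m b 0 -> m' i 0 = k ->
     (forall a, a \notin i :: writes p -> m' a = m a) ->
     I k m' -> I k.+1 (upd (den p m') i 0 k.+1)) ->
  I (m b 0) (den (PFor i b p) m).
Proof.
move=> ip I0 IS /=.
suff H k : k <= m b 0 ->
    let m' := iteri k (fun k m' => upd (den p m') i 0 k.+1) (upd m i 0 0) in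
    [/\ I k m', m' i 0 = k & forall a, a \notin i :: writes p -> m' a = m a].
  by have [] := H (m b 0) (leqnn _).
elim: k => [|k IHk] kb /=.
  split=> //; first by rewrite /upd !eqxx.
  move=> a; rewrite inE negb_or => /andP[ai _].
  by apply: funext => j; rewrite /upd (negbTE ai).
have [Ik ik fk] := IHk (ltnW kb); split; first exact: IS.
  by rewrite /upd !eqxx.
move=> a an; move: (an); rewrite inE negb_or => /andP[ai ap].
rewrite -(fk a an) -[RHS](den_frame _ ap).
by apply: funext => j; rewrite /upd (negbTE ai).
Qed.

(** * Acyclic vertex sets *)

Section Acyclic.
Variables (T : finType) (G : sgraph T).
Implicit Types (W U D : {set T}) (v a b : T).

(** Phrased with closed walks of the whole graph, so that [W] can grow and shrink without changing
    the vertex type; [fvsP] links it to induced subgraphs. *)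
Definition acyc W : Prop :=
  forall c : seq T, 2 < size c -> ucycle G c -> ~ {subset c <= W}.

Definition within W : rel T := fun x y => [&& x \in W, y \in W & G x y].
(** Reflexive on all of [T]: a vertex outside [W] is joined to itself and to nothing else. *)
Definition conn W : rel T := connect (within W).


Lemma within_sym W : connect_sym (within W).
Proof. by apply: sym_connect_sym => x y; rewrite /within adj_sym andbCA. Qed.

Lemma conn_sym W a b : conn W a b = conn W b a.
Proof. exact: within_sym. Qed.

Lemma conn_mono W W' : W \subset W' -> subrel (conn W) (conn W').
Proof.
move=> /subsetP sW; apply: connect_sub => x y /and3P[xW yW xy].
by apply: connect1; rewrite /within !sW.
Qed.

Lemma conn_edge W a b : a \in W -> b \in W -> G a b -> conn W a b.
Proof. by move=> aW bW ab; apply: connect1; rewrite /within aW bW. Qed.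

Lemma conn_in W a b : conn W a b -> a \in W -> b \in W.
Proof.
move=> /connectP[p + ->]; elim: p a => //= x p IHp a /andP[/and3P[_ xW _] /IHp].
by move=> h _; apply: h.
Qed.

Lemma path_conn W a p : path G a p -> {subset a :: p <= W} -> conn W a (last a p).
Proof.
move=> ap sW; apply/connectP; exists p => //.
elim: p a ap sW => //= x p IHp a /andP[ax xp] sW.
rewrite {1}/within !sW ?inE ?eqxx ?orbT //= ax /=; apply: IHp => // y yp.
by apply: sW; rewrite inE yp orbT.
Qed.

Lemma conn_path W a b : conn W a b -> a \in W ->
  exists p, [/\ path G a p, uniq (a :: p), {subset a :: p <= W} & b = last a p].
Proof.
move=> /connectP[p wp ->] aW.
have [q wq uq _] := shortenP wp.
exists q; split=> //; first by apply: sub_path wq => x y /and3P[].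
move=> x; rewrite inE => /predU1P[-> //|].
elim: q a {aW wp uq} wq => //= y q IHq a /andP[/and3P[_ yW _] wq].
by rewrite inE => /predU1P[-> //|]; apply: IHq wq.
Qed.

Lemma acyc_sub W W' : W \subset W' -> acyc W' -> acyc W.
Proof. by move=> /subsetP sW aW c sc uc cW; apply: (aW c sc uc) => x /cW/sW. Qed.

(** A path in [W] from [a] to [b] would close to a cycle through [v], of length at least 3 because
    [a != b]. *)
Lemma acyc_no_link W v a b : acyc (v |: W) -> v \notin W -> a \in W ->
  a != b -> G v a -> G v b -> ~~ conn W a b.
Proof.
move=> aW vW ain ab va vb; apply/negP => /conn_path-/(_ ain)[p [ap up sp eb]].
apply: (aW (v :: a :: p)).
- by case: p {ap up sp} eb ab => //= ->; rewrite eqxx.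
- rewrite /ucycle /ucycleb /= rcons_path -eb va ap adj_sym vb /=.
  by move: up => /= ->; rewrite andbT; apply: contra vW => /sp.
- by move=> x; rewrite inE => /predU1P[->|/sp xW]; rewrite in_setU1 ?eqxx // xW orbT.
Qed.

(** A new cycle passes through [v]. Rotated to start there, it leaves a path in [W] between two
    distinct neighbours of [v]. *)
Lemma acyc_setU1 W v : acyc W ->
  (forall a b, a \in W -> b \in W -> a != b -> G v a -> G v b -> ~~ conn W a b) ->
  acyc (v |: W).
Proof.
move=> aW nl c sc uc sub; case vc: (v \in c); last first.
  apply: (aW c sc uc) => x xc; have := sub x xc; rewrite in_setU1 => /orP[|//].
  by move=> /eqP xv; rewrite -xv xc in vc.
have [i c' ec] := rot_to vc.
have {uc} : ucycle G (v :: c') by rewrite -ec rot_ucycle.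
have {sub} sub : {subset c' <= v |: W}.
  by move=> x xc; apply: sub; rewrite -(mem_rot i) ec inE xc orbT.
have {sc}: 2 < size (v :: c') by rewrite -ec size_rot.
case: c' sub {ec} => //= a c' sub sc.
rewrite /ucycle /ucycleb /= rcons_path => /andP[/and3P[va ac' cv]].
rewrite !inE => /and3P[/norP[va' vc'] ac uc].
have sW : {subset a :: c' <= W}.
  move=> x xc; have := sub x xc; rewrite in_setU1 => /orP[/eqP xv|//].
  by move: xc; rewrite xv inE (negbTE va') (negbTE vc').
have lin : last a c' \in a :: c' by rewrite mem_last.
have anl : a != last a c'.
  case: c' sc ac {sub ac' cv vc' uc sW lin} => // x c' _; apply: contra => /eqP ->.
  by rewrite /= mem_last.
have := nl a (last a c'); rewrite !sW ?mem_head // va adj_sym cv.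
by move=> /(_ isT isT anl isT isT)/negP; apply; apply: path_conn.
Qed.

Lemma acyc_setU1P W v : acyc W -> v \notin W ->
  acyc (v |: W) <->
  (forall a b, a \in W -> b \in W -> a != b -> G v a -> G v b -> ~~ conn W a b).
Proof.
move=> aW vW; split; last exact: acyc_setU1.
by move=> aW' a b ain _ ab va vb; apply: acyc_no_link va vb.
Qed.

Lemma acyc_setU1_pendant W v : acyc W ->
  (forall a b, a \in W -> b \in W -> G v a -> G v b -> a = b) -> acyc (v |: W).
Proof.
move=> aW one; apply: acyc_setU1 => // a b aW' bW' /eqP ab va vb.
by case: ab; apply: one.
Qed.

Lemma fvsP S : fvs G S <-> acyc (~: S).
Proof.
split=> [fS c sc uc cS|aS c sc uc].
  have ec : c = map val (pmap insub c : seq {x : T | x \in ~: S}).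
    rewrite (pmap_filter (insubK _)); symmetry; apply/all_filterP/allP => x /cS.
    by rewrite isSome_insub.
  apply: (fS (pmap insub c)); first by rewrite -(size_map val) -ec.
  move: uc; rewrite {1}ec /ucycle /ucycleb (map_inj_uniq val_inj) cycle_map.
  by [].
apply: (aS (map val c)); first by rewrite size_map.
  by rewrite /ucycle /ucycleb (map_inj_uniq val_inj) cycle_map.
by move=> x /mapP[y _ ->]; apply: valP.
Qed.

(** Supersets of feedback vertex sets are feedback vertex sets, so removing single vertices is the
    only test needed. *)
Lemma minimal_fvsP S : minimal_fvs G S <->
  acyc (~: S) /\ forall v, v \in S -> ~ acyc (v |: ~: S).
Proof.
split=> [[/fvsP aS min]|[aS max]]; split=> //; try exact/fvsP.
  move=> v vS av; apply: (min (S :\ v)); first exact: properD1.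
  by apply/fvsP; rewrite setCD setUC.
move=> S' /properP[/subsetP sS [v vS vS']] /fvsP aS'; apply: (max v vS).
apply: acyc_sub aS'; apply/subsetP => x; rewrite !inE => /orP[/eqP -> //|].
exact/contra/sS.
Qed.

(* Vertices of U outside W are isolated for [within W], so each of them counts as
   a class of its own. *)
Definition classes_of U W := #|[set fingraph.root (within W) u | u in U]|.

(* If v is added to W, then a cycle arises or two classes of U merge. *)
Definition linked U W v : Prop :=
  (exists a b, [/\ a != b, a \in W, b \in W, G v a & G v b] /\
    (exists2 u, u \in U & conn W a u) /\ (exists2 u, u \in U & conn W b u)) \/
  (v \in U /\ exists a, [/\ a \in W, G v a & exists2 u, u \in U & conn W a u]).

Lemma linked_mono U W W' v : W \subset W' -> linked U W v -> linked U W' v.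
Proof.
move=> sW; have cW := conn_mono sW; have mW := subsetP sW.
case=> [[a [b [[ab aW bW va vb] [[u uU au] [u' u'U bu]]]]]|[vU [a [aW va [u uU au]]]]].
  by left; exists a, b; split; [split=> //; exact: mW|split; [exists u|exists u'] => //; exact: cW].
by right; split=> //; exists a; split=> //; [exact: mW|exists u => //; exact: cW].
Qed.

Lemma root_mono W W' x : W \subset W' ->
  fingraph.root (within W') (fingraph.root (within W) x) = fingraph.root (within W') x.
Proof.
move=> sW; apply/eqP; rewrite (root_connect (within_sym W')).
by rewrite (within_sym W'); apply: conn_mono sW _ _ (connect_root _ _).
Qed.

Lemma classes_imset U W W' : W \subset W' ->
  [set fingraph.root (within W') u | u in U]
  = [set fingraph.root (within W') r | r in [set fingraph.root (within W) u | u in U]].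
Proof.
by move=> sW; rewrite -imset_comp; apply: eq_imset => u /=; rewrite root_mono.
Qed.

Lemma classes_mono U W W' : W \subset W' -> classes_of U W' <= classes_of U W.
Proof. by move=> sW; rewrite /classes_of (classes_imset _ sW) leq_imset_card. Qed.

Lemma classes_le U W : classes_of U W <= #|U|.
Proof. exact: leq_imset_card. Qed.

Lemma card_imset_lt (f : T -> T) U a b :
  a \in U -> b \in U -> a != b -> f a = f b -> #|f @: U| < #|U|.
Proof.
move=> aU bU ab fab; rewrite (cardsD1 b U) bU add1n ltnS.
apply: leq_trans (leq_imset_card f _); apply/subset_leq_card/subsetP => _ /imsetP[x xU ->].
by have [->|xb] := eqVneq x b; [rewrite -fab|]; apply: imset_f; rewrite !inE ?ab ?xb.
Qed.

(** In the first case of [linked], acyclicity puts [a] and [b] in different components of [W], which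
    [v] joins. In the second, [v] is a class of its own before it enters and merges with that of
    [a]. *)
Lemma classes_lt U W v : v \notin W -> acyc (v |: W) -> linked U W v ->
  classes_of U (v |: W) < classes_of U W.
Proof.
move=> vW aW lk; have sW : W \subset v |: W by apply: subsetUr.
have ve a : a \in W -> G v a -> conn (v |: W) v a.
  by move=> aW' va; apply: conn_edge; rewrite ?in_setU1 ?eqxx // aW' orbT.
suff [u [w [uU wU nuw cuw]]] : exists u w,
    [/\ u \in U, w \in U, ~~ conn W u w & conn (v |: W) u w].
  rewrite /classes_of (classes_imset _ sW).
  apply: (card_imset_lt (imset_f _ uU) (imset_f _ wU)).
    by rewrite (root_connect (within_sym W)).
  by rewrite !root_mono //; apply/eqP; rewrite (root_connect (within_sym _)).
case: lk => [[a [b [[ab aW' bW va vb] [[u uU au] [w wU bw]]]]]|[vU [a [aW' va [u uU au]]]]].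
  exists u, w; split=> //.
    apply: contra (acyc_no_link aW vW aW' ab va vb) => uw.
    apply: connect_trans au (connect_trans uw _).
    by rewrite (within_sym W).
  rewrite /conn (within_sym _); apply: (@connect_trans _ _ b).
    by rewrite (within_sym _); apply: conn_mono bw.
  apply: (@connect_trans _ _ v); first by rewrite (within_sym _); apply: ve.
  by apply: connect_trans (ve a _ _) _ => //; apply: conn_mono au.
exists v, u; split=> //.
  apply: contra vW => vu.
  have uW : u \in W by apply: conn_in au _.
  by apply: conn_in uW; rewrite /conn (within_sym W).
by apply: connect_trans (ve a _ _) _ => //; apply: conn_mono au.
Qed.

(** The vertices of [B] enter one by one and each costs a class; by [linked_mono] those still
    waiting remain linked. *)
Lemma classes_chain U W (B : {set T}) : [disjoint B & W] -> acyc (W :|: B) ->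
  {in B, forall v, linked U W v} -> #|B| + classes_of U (W :|: B) <= classes_of U W.
Proof.
elim: {B}#|B| {-2}B (erefl #|B|) => [|k IHk] B cB dB aB lB.
  by move/eqP: cB; rewrite cards_eq0 => /eqP ->; rewrite setU0 cards0.
have /card_gt0P[v vB] : 0 < #|B| by rewrite cB.
have sB : B :\ v \subset B by apply: subD1set.
have eB : W :|: B = v |: (W :|: B :\ v) by rewrite setUCA setD1K.
have := cB; rewrite (cardsD1 v B) vB add1n => -[cB'].
have sWB : W :|: B :\ v \subset W :|: B by apply: setUS.
have := IHk _ cB' (disjointWl sB dB) (acyc_sub sWB aB) (fun x xB => lB x (subsetP sB x xB)).
rewrite cB'; apply: leq_trans; rewrite addSnnS leq_add2l eB.
apply: classes_lt; last exact: linked_mono (subsetUl _ _) (lB v vB).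
  rewrite !inE eqxx /= orbF.
  by move/pred0P: dB => /(_ v) /=; rewrite vB /= => ->.
by rewrite -eB.
Qed.

End Acyclic.

(** * Closure of a guess and the number of vertices charged to one pair *)

Section Bounds.
Variables (T : finType) (G : sgraph T).
Implicit Types (W U D Y N X M L F : {set T}) (v a b : T).
Local Notation acyc := (acyc G).
Local Notation conn := (conn G).
Local Notation linked := (linked G).
Local Notation classes_of := (classes_of G).

(** Follow the path to its first vertex [e] in [D]; [l] is the vertex just before it. *)
Lemma first_hit Y D a d : conn Y a d -> a \in Y -> a \notin D -> d \in D ->
  exists l e, [/\ l \in Y :\: D, conn (Y :\: D) a l, e \in D & G l e].
Proof.
move=> /conn_path h aY aD dD; have [p [ap _ sp ed]] := h aY.
elim: p a aY aD ap sp ed {h} => [|x p IHp] a aY aD /=.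
  by move=> _ _ ed; rewrite -ed dD in aD.
move=> /andP[ax xp] sp ed; have aN : a \in Y :\: D by rewrite inE aD.
have [xD|xD] := boolP (x \in D); first by exists a, x; split=> //; apply: connect0.
have xY : x \in Y by apply: sp; rewrite !inE eqxx orbT.
have sp' : {subset x :: p <= Y} by move=> y yp; apply: sp; rewrite inE yp orbT.
have [l [e [lN xl eD le]]] := IHp x xY xD xp sp' ed.
exists l, e; split=> //; apply: connect_trans xl.
by apply: conn_edge ax; rewrite // inE xD.
Qed.

Lemma conn_inside_or_meets Y F a b : conn Y a b -> a \in Y ->
  conn (Y :&: F) a b \/ exists s, [/\ s \in Y, s \notin F, conn Y a s & conn Y b s].
Proof.
move=> ab aY; have [p [ap _ sp eb]] := conn_path ab aY.
suff [?|[s [sY sF cs]]] : conn (Y :&: F) a b \/ exists s, [/\ s \in Y, s \notin F & conn Y a s].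
- by left.
- right; exists s; split=> //; apply: connect_trans cs.
  by rewrite (within_sym G Y).
rewrite eb; elim: p a aY ap sp {ab eb} => [|x p IHp] a aY /=.
  by left; apply: connect0.
move=> /andP[ax xp] sp.
have xY : x \in Y by apply: sp; rewrite !inE eqxx orbT.
have [aF|aF] := boolP (a \in F); last by right; exists a; split=> //; apply: connect0.
have cax : conn Y a x by apply: conn_edge.
have [xF|xF] := boolP (x \in F); last by right; exists x.
case: (IHp x xY xp) => [y yp|cxl|[s [sY sF cs]]]; first by apply: sp; rewrite inE yp orbT.
  by left; apply: connect_trans cxl; apply: conn_edge ax; rewrite inE ?aY ?xY.
by right; exists s; split=> //; apply: connect_trans cs.
Qed.

(** Keep adding vertices with two neighbours in [D]. All of [D] is joined to [U] inside [D], so each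
    addition merges two classes of [U]: the sum of [#|D|] and the number of classes never grows, and
    it starts at most at [2 * #|U|]. *)
Lemma closure_ex Y U : acyc Y -> U \subset Y ->
  exists D, [/\ U \subset D, D \subset Y, #|D| <= 2 * #|U|,
    {in D, forall d, exists2 u, u \in U & conn D d u} &
    {in Y :\: D, forall v a b, a \in D -> b \in D -> G v a -> G v b -> a = b}].
Proof.
move=> aY sUY.
suff H k D : #|Y :\: D| <= k -> U \subset D -> D \subset Y ->
    #|D| + classes_of U D <= 2 * #|U| ->
    {in D, forall d, exists2 u, u \in U & conn D d u} ->
  exists D, [/\ U \subset D, D \subset Y, #|D| <= 2 * #|U|,
    {in D, forall d, exists2 u, u \in U & conn D d u} &
    {in Y :\: D, forall v a b, a \in D -> b \in D -> G v a -> G v b -> a = b}].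
  apply: (H _ U (leqnn _)) => //.
    by rewrite mul2n -addnn leq_add2l classes_le.
  by move=> u uU; exists u => //; apply: connect0.
elim: k D => [|k IHk] D cD sUD sDY cl cn.
  exists D; split=> //; first exact: leq_trans (leq_addr _ _) cl.
  by move=> v; move: cD; rewrite leqn0 cards_eq0 => /eqP ->; rewrite inE.
have [[v [a [b [vY aD bD va vb]]]]|no] := pselect (exists v a b,
   [/\ v \in Y :\: D, a \in D, b \in D, G v a & G v b /\ a != b]); last first.
  exists D; split=> //; first exact: leq_trans (leq_addr _ _) cl.
  move=> v vY a b aD bD va vb; apply/eqP/negPn/negP => ab.
  by apply: no; exists v, a, b.
move: vb => [vb ab].

move: vY; rewrite inE => /andP[vD vY].
have sY : v |: D \subset Y by rewrite subUset sub1set vY.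
have sD : D \subset v |: D by apply: subsetUr.
have lv : linked U D v by left; exists a, b; split=> //; split; apply: cn.
have lt := classes_lt vD (acyc_sub sY aY) lv.
apply: (IHk (v |: D)) => //.
- have -> : Y :\: (v |: D) = (Y :\: D) :\ v by rewrite setDDl setUC.
  by move: cD; rewrite (cardsD1 v (Y :\: D)) inE vD vY.
- exact: subset_trans sUD sD.
- by rewrite cardsU1 vD add1n addSnnS; apply: leq_trans cl; rewrite leq_add2l.
- move=> d; rewrite in_setU1 => /predU1P[->|/cn[u uU du]]; last first.
    by exists u => //; apply: conn_mono du.
  have [u uU au] := cn a aD; exists u => //.
  apply: (@connect_trans _ _ a); last exact: conn_mono au.
  by apply: conn_edge va; rewrite in_setU1 ?eqxx // aD orbT.
Qed.

(** [L] has at most [#|L|] classes over [N]; each vertex of [X] removes one, and the rest of [M] can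
    only merge more. *)
Lemma linked_card_bound M L N X : acyc M -> N \subset M -> X \subset M ->
  [disjoint X & N] -> {in X, forall x, linked L N x} ->
  #|X| + classes_of L M <= #|L|.
Proof.
move=> aM sN sX dX lX; have sNX : N :|: X \subset M by rewrite subUset sN.
have h1 := classes_chain dX (acyc_sub sNX aM) lX.
have h2 := classes_mono G L sNX.
have h3 := classes_le G L N; lia.
Qed.

(** The form used for lower bounds on solutions: the complement of [W'] contains all but [#|D|] of
    the vertices of [B]. *)
Lemma linked_extension_bound D W W' (B : {set T}) : W \subset W' -> acyc W' ->
  [disjoint B & W] -> {in B, forall v, linked D W v} -> #|W' :&: B| <= #|D|.
Proof.
move=> sW aW' dB lB.
have sWB : W :|: W' :&: B \subset W' by rewrite subUset sW subsetIl.
have := classes_chain (disjointWl (subsetIr W' B) dB) (acyc_sub sWB aW')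
  (fun v vB => lB v (subsetP (subsetIr W' B) v vB)).
have := classes_le G D W; lia.
Qed.

Lemma independent_classes M L (R : {set T}) : R \subset L ->
  {in R &, forall a b, conn M a b -> a = b} -> #|R| <= classes_of L M.
Proof.
move=> sR iR; have inj : {in R &, injective (fingraph.root (within G M : rel T))}.
  by move=> a b aR bR /eqP; rewrite (root_connect (within_sym G M)); apply: iR.
by rewrite -(card_in_imset inj); apply/subset_leq_card/imsetS.
Qed.

Definition deg_in D v := #|[set d in D | G v d]|.
(** In the letters of the overview, [heavy] is A, [labelled] is L and [middle] is the forest F \ (D
    u A). *)
Definition middle F D := [set v in F :\: D | deg_in D v <= 1].
Definition labelled F D := [set v in middle F D | deg_in D v == 1].
Definition heavy F D := [set v in F :\: D | 1 < deg_in D v].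

Lemma deg_in_gt0 D v d : d \in D -> G v d -> 0 < deg_in D v.
Proof. by move=> dD vd; apply/card_gt0P; exists d; rewrite inE dD. Qed.

Lemma deg_in_gt1 D v a b : a \in D -> b \in D -> G v a -> G v b -> a != b -> 1 < deg_in D v.
Proof.
move=> aD bD va vb ab; have <- : #|[set a; b]| = 2 by rewrite cards2 ab.
by apply/subset_leq_card/subsetP => x; rewrite !inE => /orP[]/eqP ->; rewrite ?aD ?bD.
Qed.

Lemma deg_in_le1 D v : deg_in D v <= 1 ->
  forall a b, a \in D -> b \in D -> G v a -> G v b -> a = b.
Proof.
move=> le1 a b aD bD va vb; apply/eqP; apply: contraTT le1 => ab.
by rewrite -ltnNge (deg_in_gt1 aD bD).
Qed.

Lemma deg_in_gt1P D v : 1 < deg_in D v ->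
  exists a b, [/\ a != b, a \in D, b \in D, G v a & G v b].
Proof.
move=> /card_gt1P[a [b [+ + ab]]]; rewrite !inE => /andP[aD va] /andP[bD vb].
by exists a, b.
Qed.

Lemma labelledP F D v : v \in labelled F D ->
  v \in middle F D /\ exists2 d, d \in D & G v d.
Proof.
rewrite inE => /andP[-> /eqP d1]; split=> //.
have /card_gt0P[d] : 0 < deg_in D v by rewrite d1.
by rewrite inE => /andP[dD vd]; exists d.
Qed.

(** From a neighbour outside [D], walk inside [Y] towards [D]: the last vertex before [D] has
    exactly one neighbour there, by closure, so it is labelled. A neighbour in [D] makes [x] itself
    labelled. These are the two cases of [linked]; two neighbours in [D] would make [x] heavy. *)
Lemma linked_transfer F D Y x a b : D \subset Y -> Y \subset F :|: D ->
  {in Y :\: D, forall v a b, a \in D -> b \in D -> G v a -> G v b -> a = b} ->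
  x \in F -> x \notin Y -> x \notin heavy F D ->
  a != b -> a \in Y -> b \in Y -> G x a -> G x b ->
  (exists2 d, d \in D & conn Y a d) -> (exists2 d, d \in D & conn Y b d) ->
  [/\ x \in middle F D & linked (labelled F D) (Y :\: D) x].
Proof.
move=> sDY sYF one xF xY xA ab aY bY xa xb [d dD ad] [e eD be].
have xD : x \notin D by apply: contra xY => /(subsetP sDY).
have xd : deg_in D x <= 1 by move: xA; rewrite !inE xF xD /= -leqNgt.
have xM : x \in middle F D by rewrite !inE xF xD.
have arm c f : c \in Y -> c \notin D -> f \in D -> conn Y c f ->
    exists2 l, l \in labelled F D & conn (Y :\: D) c l.
  move=> cY cD fD cf; have [l [g [lN cl gD lg]]] := first_hit cf cY cD fD.
  exists l => //; move: (lN); rewrite inE => /andP[lD lY].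
  have lF : l \in F by have := subsetP sYF l lY; rewrite inE (negbTE lD) orbF.
  have l1 : deg_in D l <= 1.
    rewrite leqNgt; apply/negP => /deg_in_gt1P[p [q [pq pD qD lp lq]]].
    by move/eqP: pq; apply; apply: one lp lq.
  by rewrite !inE lF lD l1 /= eqn_leq l1 (deg_in_gt0 gD lg).
have lab c : c \in D -> G x c -> x \in labelled F D.
  by move=> cD xc; rewrite inE xM eqn_leq xd (deg_in_gt0 cD xc).
split=> //; have [aD|aD] := boolP (a \in D); have [bD|bD] := boolP (b \in D).
- by have := deg_in_gt1 aD bD xa xb ab; rewrite ltnNge xd.
- right; split; first exact: lab aD xa.
  by exists b; split=> //; [rewrite inE bD | apply: arm be].
- right; split; first exact: lab bD xb.
  by exists a; split=> //; [rewrite inE aD | apply: arm ad].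
- left; exists a, b; split; first by split=> //; rewrite inE ?aD ?bD.
  by split; [apply: arm ad | apply: arm be].
Qed.

(* With U the remaining vertices of two parts of S0 and Y the solution-free part of
   F u U, these are the vertices charged to the pair of parts. *)
Definition touching Y U F : {set T} := [set x in F :\: Y |
  `[< exists a b, [/\ a != b, a \in Y, b \in Y, G x a & G x b] /\
    (exists2 u, u \in U & conn Y a u) /\ (exists2 u, u \in U & conn Y b u) >]].

(** Closure places [Y :\: D] inside [middle F D], so the charged vertices that are not heavy are
    counted by [linked_card_bound] in this forest; all heavy ones are simply added. *)
Lemma touching_bound F Y U D : acyc F -> U \subset D -> D \subset Y -> Y \subset F :|: D ->
  {in Y :\: D, forall v a b, a \in D -> b \in D -> G v a -> G v b -> a = b} ->
  #|touching Y U F| + classes_of (labelled F D) (middle F D)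
    <= #|heavy F D| + #|labelled F D|.
Proof.
move=> aF sUD sDY sYF one.
have sMF : middle F D \subset F by apply/subsetP => v; rewrite !inE => /andP[/andP[]].
have sN : Y :\: D \subset middle F D.
  apply/subsetP => v vN; move: (vN); rewrite !inE => /andP[vD vY].
  have := subsetP sYF v vY; rewrite inE (negbTE vD) orbF => -> /=.
  rewrite leqNgt; apply/negP => /deg_in_gt1P[p [q [pq pD qD lp lq]]].
  by move/eqP: pq; apply; apply: one lp lq.
have tr x : x \in touching Y U F :\: heavy F D ->
    [/\ x \in middle F D & linked (labelled F D) (Y :\: D) x].
  move=> /setDP[+ xA]; rewrite inE => /andP[/setDP[xF xY]].
  move=> /asboolP[a [b [[ab aY bY xa xb] [[u uU au] [w wU bw]]]]].
  apply: (linked_transfer sDY sYF one xF xY xA ab aY bY xa xb).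
    by exists u => //; apply: (subsetP sUD).
  by exists w => //; apply: (subsetP sUD).
have := @linked_card_bound (middle F D) (labelled F D) (Y :\: D)
  (touching Y U F :\: heavy F D) (acyc_sub sMF aF) sN.
have -> : touching Y U F :\: heavy F D \subset middle F D by apply/subsetP => x /tr[].
have dis : [disjoint touching Y U F :\: heavy F D & Y :\: D].
  rewrite disjoint_subset; apply/subsetP => x /setDP[+ _].
  by rewrite inE => /andP[/setDP[_ xY] _]; rewrite !inE (negbTE xY) andbF.
move=> /(_ isT dis (fun x xX => (tr x xX).2)).
have := cardsID (heavy F D) (touching Y U F).
have : #|touching Y U F :&: heavy F D| <= #|heavy F D| by apply/subset_leq_card/subsetIr.
lia.
Qed.

End Bounds.

(** * The two-colouring *)

Section Colouring.
Variables (T : finType) (G : sgraph T) (F D : {set T}).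
Hypotheses (aF : acyc G F) (aD : acyc G D).
Implicit Types (R W : {set T}) (col : T -> nat) (v p a b : T).
Local Notation M := (middle G F D).
Local Notation L := (labelled G F D).
Local Notation conn := (conn G).

(** Colour 0 means not yet coloured. The colours proper are 1 and 2, exchanged by [3 - _], and [D]
    belongs to both classes. *)
Definition colour_class col c : {set T} := D :|: [set v | col v == c].

Definition coloured col : {set T} := [set v | col v != 0].

(** The invariant of the colouring process. No rooting is stored: [R] holds the vertices at which a
    tree was entered, and [col_parent] retains the one fact about parents used later, an opposite
    colour above each labelled vertex that is not a root. *)
Record colouring col R : Prop := Colouring {
  col_middle : coloured col \subset M;
  col_le2 v : col v <= 2;
  roots_labelled : R \subset L;
  roots_coloured : R \subset coloured col;
  roots_indep : {in R &, forall a b, conn M a b -> a = b};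
  col_conn a b : a \in coloured col -> b \in coloured col ->
    conn M a b -> conn (coloured col) a b;
  col_acyc c : 0 < c -> acyc G (colour_class col c);
  col_anchor v : v \in coloured col ->
    exists2 d, d \in D & conn (colour_class col (col v)) v d;
  col_parent v : v \in L :\: R -> v \in coloured col ->
    exists2 p, G v p & col p = 3 - col v }.

(** Each tree of [M] is coloured entirely or not at all, the situation in which a new root may be
    chosen. *)
Definition col_closed col := forall p v,
  p \in coloured col -> v \in M -> G p v -> v \in coloured col.

Lemma acyc_middle : acyc G M.
Proof. by apply: acyc_sub aF; apply/subsetP => v; rewrite !inE => /andP[/andP[]]. Qed.

Lemma middle_D v : v \in M -> v \notin D.
Proof. by rewrite !inE => /andP[/andP[]]. Qed.

Lemma col_closed_conn col a b : col_closed col -> a \in coloured col ->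
  conn M a b -> b \in coloured col.
Proof.
move=> cl + /connectP[p + ->]; elim: p a => //= x p IHp a aC /andP[/and3P[_ xM ax] xp].
by apply: IHp => //; apply: cl ax.
Qed.

Lemma colouring0 : colouring (fun=> 0) set0.
Proof.
split; rewrite ?sub0set //.
- by move=> a b; rewrite inE.
- by move=> a b; rewrite inE.
- move=> c c0; rewrite /colour_class.
  have -> : [set v : T | 0 == c] = set0 by apply/setP => v; rewrite !inE eq_sym gtn_eqF.
  by rewrite setU0.
- by move=> v; rewrite inE.
- by move=> v _; rewrite inE.
Qed.

Section Step.
Variables (col col' : T -> nat) (v : T).
Hypotheses (v0 : col v = 0) (same : forall w, w != v -> col' w = col w).

Lemma class_step c : 0 < c ->
  colour_class col' c = if col' v == c then v |: colour_class col c else colour_class col c.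
Proof.
move=> c0; apply/setP => w; rewrite /colour_class; have [->|wv] := eqVneq w v.
  by case: ifPn => cv; rewrite !inE ?eqxx ?cv ?orbT // (negbTE cv) v0 eq_sym gtn_eqF.
by case: ifP; rewrite !inE (same wv) ?(negbTE wv).
Qed.

Lemma class_step_sub c : 0 < c -> colour_class col c \subset colour_class col' c.
Proof. by move=> c0; rewrite class_step //; case: ifP; rewrite ?subsetUr. Qed.

Hypothesis v1 : col' v != 0.

Lemma coloured_step : coloured col' = v |: coloured col.
Proof.
apply/setP => w; rewrite !inE; have [->|wv] := eqVneq w v; first by rewrite v1.
by rewrite same.
Qed.

(** The tree of [v] is still uncoloured, so the only neighbour of [v] in its class is the one in
    [D]: [v] is pendant and anchored there. *)
Lemma colouring_root R : colouring col R -> col_closed col -> v \in L -> col' v = 1 ->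
  colouring col' (v |: R).
Proof.
move=> cR cl vL c1; have [vM [d dD vd]] := labelledP vL.
have sK : coloured col \subset coloured col' by rewrite coloured_step subsetUr.
have vK : v \notin coloured col by rewrite inE v0.
have nvK a : a \in coloured col -> ~ conn M v a.
  move=> aK va; case/negP: vK; apply: (col_closed_conn cl aK).
  by rewrite conn_sym.
have nKv a : a \in coloured col -> ~ conn M a v.
  by move=> aK; rewrite conn_sym; apply: nvK.
have vd1 : deg_in G D v <= 1 by move: vM; rewrite inE => /andP[].
split.
- by rewrite coloured_step subUset sub1set vM (col_middle cR).
- by move=> w; have [->|wv] := eqVneq w v; rewrite ?c1 // same // (col_le2 cR).
- by rewrite subUset sub1set vL (roots_labelled cR).
- by rewrite subUset sub1set inE v1 (subset_trans (roots_coloured cR)).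
- have rK a : a \in R -> a \in coloured col by move/(subsetP (roots_coloured cR)).
  move=> a b; rewrite !in_setU1 => /predU1P[->|aR] /predU1P[->|bR] //.
  + by move=> /nvK-/(_ (rK _ bR)).
  + by move=> /nKv-/(_ (rK _ aR)).
  + exact: (roots_indep cR).
- move=> a b; rewrite {1 2}coloured_step !in_setU1.
  move=> /predU1P[->|aK] /predU1P[->|bK]; first by move=> _; apply: connect0.
  + by move=> /(nvK _ bK).
  + by move=> /(nKv _ aK).
  + by move=> /(col_conn cR aK bK); apply: conn_mono.
- move=> c c0; rewrite class_step //; case: ifP => [/eqP ec|_]; last exact: (col_acyc cR).
  apply: acyc_setU1_pendant; first exact: (col_acyc cR).
  have inD a : a \in colour_class col c -> G v a -> a \in D.
    rewrite in_setU => /orP[//|]; rewrite inE => /eqP ca va.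
    have aK : a \in coloured col by rewrite inE ca -lt0n.
    by case/negP: vK; apply: (cl a) aK vM _; rewrite adj_sym.
  move=> a b aW bW va vb.
  exact: (deg_in_le1 vd1 (inD _ aW va) (inD _ bW vb)).
- move=> w; rewrite {1}coloured_step in_setU1 => /predU1P[->|wK].
    exists d => //; apply: conn_edge vd; rewrite c1 class_step // c1 /= ?in_setU1 ?eqxx //.
    by rewrite in_setU dD orbT.
  have wv : w != v by apply: contraNneq vK => <-.
  rewrite same //; have [e eD we] := col_anchor cR wK; exists e => //.
  by apply: conn_mono we; apply: class_step_sub; move: wK; rewrite inE lt0n.
- move=> w; rewrite in_setD in_setU1 negb_or -andbA => /and3P[wv wR wL].
  rewrite coloured_step in_setU1 (negbTE wv) /= => wK.
  have [|p wp cp] := col_parent cR _ wK; first by rewrite in_setD wR.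
  exists p => //; rewrite !same //; apply: contraTneq wK => pv.
  by move: cp; rewrite pv v0 => /esym/eqP; rewrite subn_eq0 leqNgt ltnS (col_le2 cR).
Qed.

(** [p] is the only coloured neighbour of [v]: by [col_conn] a second one would close a cycle in
    [M]. If [v] is labelled, the colour changes and its neighbour in its class is the one in [D]; if
    not, it has none in [D] and only [p] is left. Either way [v] enters its class as a pendant
    vertex. *)
Lemma colouring_child R p : colouring col R -> p \in coloured col -> v \in M -> G v p ->
  col' v = (if v \in L then 3 - col p else col p) -> colouring col' R.
Proof.
move=> cR pK vM vp cv.
have sK : coloured col \subset coloured col' by rewrite coloured_step subsetUr.
have vK : v \notin coloured col by rewrite inE v0.
have vd1 : deg_in G D v <= 1 by move: vM; rewrite inE => /andP[].
have pM := subsetP (col_middle cR) p pK.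
have cp0 : 0 < col p <= 2 by rewrite (col_le2 cR) lt0n; move: pK; rewrite inE => ->.
have cv0 : 0 < col' v <= 2 by rewrite cv; case: ifP; lia.
have onlyp a : a \in coloured col -> G v a -> a = p.
  move=> aK va; apply/eqP/negPn/negP => ap; have aM := subsetP (col_middle cR) a aK.
  have cap : conn M a p.
    by apply: (@connect_trans _ _ v); apply: conn_edge; rewrite // adj_sym.
  have aKv : acyc G (v |: coloured col).
    apply: acyc_sub acyc_middle; by rewrite subUset sub1set vM (col_middle cR).
  by have := acyc_no_link aKv vK aK ap va vp; rewrite (col_conn cR aK pK cap).
have vpK : conn (coloured col') v p.
  by apply: conn_edge => //; [rewrite inE v1 | apply: (subsetP sK)].
have toK a : a \in coloured col -> conn M v a -> conn (coloured col') v a.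
  move=> aK va; apply: connect_trans vpK _; apply: conn_mono sK _ _ _.
  apply: (col_conn cR) => //; apply: connect_trans va; apply: conn_edge => //.
  by rewrite adj_sym.
split.
- by rewrite coloured_step subUset sub1set vM (col_middle cR).
- by move=> w; have [->|wv] := eqVneq w v; [lia | rewrite same // (col_le2 cR)].
- exact: (roots_labelled cR).
- exact: subset_trans (roots_coloured cR) sK.
- exact: (roots_indep cR).
- move=> a b; rewrite {1 2}coloured_step !in_setU1.
  move=> /predU1P[->|aK] /predU1P[->|bK]; first by move=> _; apply: connect0.
  + exact: toK.
  + by rewrite conn_sym [conn (coloured col') _ _]conn_sym; apply: toK.
  + by move=> /(col_conn cR aK bK); apply: conn_mono.
- move=> c c0; rewrite class_step //; case: ifP => [/eqP ec|_]; last exact: (col_acyc cR).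
  apply: acyc_setU1_pendant; first exact: (col_acyc cR).
  have inW a : a \in colour_class col c -> G v a ->
      if v \in L then a \in D else a == p.
    rewrite in_setU inE => /orP[aD'|/eqP ca] va.
      case: ifPn => // /negP[]; rewrite inE vM eqn_leq vd1.
      exact: deg_in_gt0 aD' va.
    have ap : a = p by apply: onlyp; rewrite // inE ca -lt0n.
    by rewrite ap eqxx; case: ifP => // vL; move: cv; rewrite vL ec -ca ap; lia.
  move=> a b /inW+ /inW+ va vb; move=> /(_ va) + /(_ vb); case: ifP => _.
    by move=> aD' bD'; apply: deg_in_le1 vd1 a b aD' bD' va vb.
  by move=> /eqP -> /eqP ->.
- move=> w; rewrite {1}coloured_step in_setU1 => /predU1P[->|wK].
    have vW : v \in colour_class col' (col' v) by rewrite in_setU inE eqxx orbT.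
    have [vL|vL] := boolP (v \in L).
      have [_ [d dD vd]] := labelledP vL; exists d => //; apply: conn_edge vd => //.
      by rewrite in_setU dD.
    have pv : p != v by apply: contraNneq vK => <-.
    have [e eD pe] := col_anchor cR pK; exists e => //.
    have ecv : col' v = col p by rewrite cv (negbTE vL).
    apply: (@connect_trans _ _ p).
      by apply: conn_edge vp => //; rewrite in_setU inE same // ecv eqxx orbT.
    by rewrite ecv; apply: conn_mono pe; apply: class_step_sub; case/andP: cp0.
  have wv : w != v by apply: contraNneq vK => <-.
  rewrite same //; have [e eD we] := col_anchor cR wK; exists e => //.
  by apply: conn_mono we; apply: class_step_sub; move: wK; rewrite inE lt0n.
- move=> w wLR; rewrite coloured_step in_setU1 => /predU1P[wv|wK].
    move: wLR; rewrite wv in_setD => /andP[_ vL]; exists p => //.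
    have pv : p != v by apply: contraNneq vK => <-.
    by rewrite same // cv vL; lia.
  have wv : w != v by apply: contraNneq vK => <-.
  have [q wq cq] := col_parent cR wLR wK.
  exists q => //; rewrite !same //; apply: contraTneq wK => qv.
  by move: cq; rewrite qv v0 => /esym/eqP; rewrite subn_eq0 leqNgt ltnS (col_le2 cR).
Qed.

End Step.

(** Over the class of colour [c], heavy vertices are linked to [D] by two neighbours in [D], and
    labelled non-roots of the other colour by their neighbour in [D] and their parent, which has
    colour [c]. All but [#|D|] of them avoid the superset. Summing over both colours counts heavy
    vertices twice and non-roots once; the roots lie in different trees and are paid for by the
    classes. *)
Lemma colouring_escape col R W1 W2 : colouring col R -> L \subset coloured col ->
  acyc G W1 -> acyc G W2 ->
  colour_class col 1 \subset W1 -> colour_class col 2 \subset W2 ->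
  2 * #|heavy G F D| + #|L| <= #|~: W1| + #|~: W2| + 2 * #|D| + classes_of G L M.
Proof.
move=> cR sL a1 a2 s1 s2.
have bound c W : 0 < c <= 2 -> acyc G W -> colour_class col c \subset W ->
    #|heavy G F D| + #|[set v in L :\: R | col v == 3 - c]| <= #|~: W| + #|D|.
  move=> c12 aW sW; set H := heavy G F D; set E := [set v in _ | _].
  have dHE : [disjoint H & E].
    rewrite disjoint_subset; apply/subsetP => v; rewrite inE => /andP[_ vd].
    by rewrite 6!inE leqNgt vd /= !andbF.
  have lk : {in H :|: E, forall v, linked G D (colour_class col c) v}.
    move=> v; rewrite in_setU => /orP[|].
      rewrite inE => /andP[_ /deg_in_gt1P[a [b [ab aD' bD' va vb]]]].
      left; exists a, b; split; first by split; rewrite // in_setU ?aD' ?bD'.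
      by split; [exists a|exists b]; rewrite // ?aD' ?bD' //; apply: connect0.
    rewrite inE => /andP[vLR /eqP cv]; have vL : v \in L by case/setDP: vLR.
    have [_ [d dD vd]] := labelledP vL.
    have [p vp cp] := col_parent cR vLR (subsetP sL v vL).
    have {}cp : col p = c by lia.
    have pK : p \in coloured col by rewrite inE cp; lia.
    have [e eD] := col_anchor cR pK; rewrite cp => pe.
    have pD : p \notin D by apply: middle_D; apply: (subsetP (col_middle cR)).
    left; exists d, p; split; first split=> //.
    - by apply: contraNneq pD => <-.
    - by rewrite in_setU dD.
    - by rewrite in_setU inE cp eqxx orbT.
    - by split; [exists d => //; apply: connect0 | exists e].
  have dW : [disjoint H :|: E & colour_class col c].
    rewrite disjoint_subset; apply/subsetP => v; rewrite in_setU => /orP[|].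
      move=> vH; rewrite !inE negb_or; move: (vH); rewrite !inE => /andP[/andP[-> _] vd] /=.
      apply: contraL vd => /eqP cv; rewrite -leqNgt.
      have := subsetP (col_middle cR) v; rewrite !inE cv.
      by move=> /(_ _)/andP[|_ //]; lia.
    rewrite inE => /andP[/setDP[vL _] /eqP cv]; have [vM _] := labelledP vL.
    by rewrite !inE negb_or (middle_D vM) cv /=; lia.
  have := linked_extension_bound sW aW dW lk.
  have := cardsID W (H :|: E); rewrite setIC.
  have : #|(H :|: E) :\: W| <= #|~: W| by apply/subset_leq_card/subsetP => x; rewrite !inE => /andP[].
  have : #|H :|: E| = #|H| + #|E| by exact: eqTleqif (leq_card_setU H E) dHE.
  lia.
have b1 := bound 1 W1 isT a1 s1; have b2 := bound 2 W2 isT a2 s2.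
have rb := independent_classes (roots_labelled cR) (roots_indep cR).
have e : #|L| = #|R| + #|L :\: R|.
  by rewrite -(cardsID R L) (setIidPr (roots_labelled cR)).
have : #|L :\: R| <= #|[set v in L :\: R | col v == 3 - 1]|
    + #|[set v in L :\: R | col v == 3 - 2]|.
  apply: leq_trans (leq_card_setU _ _).1; apply/subset_leq_card/subsetP => v vLR.
  have : v \in coloured col by case/setDP: vLR => /(subsetP sL).
  rewrite inE in_setU [X in X || _]inE [X in _ || X]inE vLR /=.
  by have := col_le2 cR v; lia.
lia.
Qed.

End Colouring.

(** * Charging to pairs of parts *)

Section Approximation.
Variables (T : finType) (G : sgraph T) (F : {set T}) (V : nat).
Hypotheses (aF : acyc G F) (FV : #|~: F| <= V).
Implicit Types (D S U Y : {set T}).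

(** What trying [D] guarantees once every set found has complement of size at most [V]. The second
    clause serves the charging argument, the first the case in which all sets are enumerated. *)
Definition explored D : Prop :=
  (exists W, [/\ acyc G W, D \subset W & #|~: W| <= V]) /\
  2 * #|heavy G F D| + #|labelled G F D|
    <= 2 * V + 2 * #|D| + classes_of G (labelled G F D) (middle G F D).

(** The 6 is 2 + 4: the bound is [2 * V + 2 * #|D|], and [#|D| <= 2 * #|U| <= 2 * V]. *)
Lemma touching_le Y U : acyc G Y -> U \subset Y -> Y \subset F :|: U ->
  #|U| <= V -> (forall D, acyc G D -> #|D| <= 2 * #|U| -> explored D) ->
  #|touching G Y U F| <= 6 * V.
Proof.
move=> aY sUY sYF UV expl; have [D [sUD sDY cD _ one]] := closure_ex aY sUY.
have sYFD : Y \subset F :|: D by apply: subset_trans sYF (setUS _ sUD).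
have := touching_bound aF sUD sDY sYFD one.
have [_] := expl D (acyc_sub sDY aY) cD; lia.
Qed.

Lemma card_fibre (A : {set T}) h i :
  0 < h -> #|[set u in A | index u (enum A) %/ h == i]| <= h.
Proof.
move=> h0.
rewrite cardE -(size_map (index^~ (enum A))) -{2}(size_iota (i * h) h).
apply: uniq_leq_size.
  rewrite map_inj_in_uniq ?enum_uniq // => x y.
  rewrite !mem_enum !inE => /andP[xA _] /andP[yA _] e.
  by rewrite -(nth_index x (_ : x \in enum A)) ?mem_enum // e nth_index ?mem_enum.
move=> k /mapP[u]; rewrite mem_enum inE => /andP[_ /eqP <-] ->.
rewrite mem_iota leq_trunc_div /= addnC -mulSn; exact: ltn_ceil.
Qed.

(** By minimality [x] closes a cycle with the complement of [S], and this cycle leaves the acyclic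
    set [F]. Walking from the neighbours [a] and [b] of [x] to the first vertices [u] and [w]
    outside [F] uses only vertices of [F] outside [S] before the end, so these connections survive
    in every [Y] containing such vertices and the endpoint. *)
Lemma exists_hit S x : minimal_fvs G S -> x \in S -> x \in F ->
  exists a b u w, [/\ a != b, G x a, G x b, a \in ~: S & b \in ~: S] /\
   [/\ u \in ~: S :\: F, w \in ~: S :\: F,
     forall Y, F :&: ~: S \subset Y -> u \in Y -> a \in Y /\ conn G Y a u &
     forall Y, F :&: ~: S \subset Y -> w \in Y -> b \in Y /\ conn G Y b w].
Proof.
move=> /minimal_fvsP[aS maxS] xS xF.
have [a [b [[aW bW ab xa xb] cab]]] : exists a b,
    [/\ a \in ~: S, b \in ~: S, a != b, G x a & G x b] /\ conn G (~: S) a b.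
  apply: contrapT => no; apply: (maxS x xS); apply: acyc_setU1 => // a b aW bW ab xa xb.
  by apply/negP => cab; apply: no; exists a, b.
have [s [sW sF cas cbs]] : exists s, [/\ s \in ~: S, s \notin F,
    conn G (~: S) a s & conn G (~: S) b s].
  have cba : conn G (~: S) b a by rewrite /conn (within_sym G).
  have [aF'|aF'] := boolP (a \in F); last by exists a; split=> //; apply: connect0.
  have [c|//] := conn_inside_or_meets F cab aW.
  have aSF : acyc G (x |: (~: S :&: F)).
    by apply: acyc_sub aF; rewrite subUset sub1set xF subsetIr.
  have xn : x \notin ~: S :&: F by rewrite !inE xS.
  by have := acyc_no_link aSF xn _ ab xa xb; rewrite c inE aW aF' => /(_ isT).
have hit c : c \in ~: S -> conn G (~: S) c s -> exists2 u, u \in ~: S :\: F &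
    forall Y, F :&: ~: S \subset Y -> u \in Y -> c \in Y /\ conn G Y c u.
  move=> cW cs; have [cF|cF] := boolP (c \in F); last first.
    by exists c; [rewrite inE cF | move=> Y _ cY; split=> //; apply: connect0].
  have cD : c \notin ~: S :\: F by rewrite inE cF.
  have sD : s \in ~: S :\: F by rewrite inE sF.
  have [l [u [lN cl uD lu]]] := first_hit cs cW cD sD.
  have sN : ~: S :\: (~: S :\: F) \subset F :&: ~: S.
    by apply/subsetP => y; rewrite !inE; case: (y \in F); case: (y \in S).
  exists u => // Y sY uY; have sNY := subset_trans sN sY; split.
    by apply: (subsetP sY); rewrite inE cF.
  apply: connect_trans (conn_mono sNY cl) _; apply: conn_edge lu => //.
  exact: (subsetP sNY).
have [u uD hu] := hit a aW cas; have [w wD hw] := hit b bW cbs.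
by exists a, b, u, w; split; split.
Qed.

Lemma card_bigcup_le (I : finType) (f : I -> {set T}) k :
  (forall i, #|f i| <= k) -> #|\bigcup_i f i| <= #|I| * k.
Proof.
move=> fk; apply: (@leq_trans (\sum_i #|f i|)).
  apply: (big_ind2 (fun (A : {set T}) n => #|A| <= n)) => //; first by rewrite cards0.
  move=> A m B n Am Bn; apply: leq_trans (leq_card_setU A B).1 _; exact: leq_add.
by rewrite -sum_nat_const; apply: leq_sum => i _; apply: fk.
Qed.

(** [S] is covered by the complement of [F] and the vertices charged to the [q * q] ordered pairs. A
    pair has at most [2 * h] vertices, so its closure has at most [4 * h]. *)
Lemma approximation S q h : minimal_fvs G S -> #|~: F| <= h * q ->
  (forall D, acyc G D -> #|D| <= 4 * h -> explored D) ->
  #|S| <= V + 6 * (q * q) * V.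
Proof.
move=> mS cF expl; have [aS _] := (minimal_fvsP G S).1 mS.
set f := fun u => index u (enum (~: F)) %/ h.
pose U (p : 'I_q * 'I_q) : {set T} :=
  [set u in ~: S :\: F | (f u == p.1) || (f u == p.2)].
pose Y p := (F :&: ~: S) :|: U p.
have sUS p : U p \subset ~: S by apply/subsetP => u; rewrite inE => /andP[/setDP[]].
have sYS p : Y p \subset ~: S by rewrite subUset subsetIr sUS.
have cU p : #|U p| <= V.
  apply: leq_trans FV; apply/subset_leq_card/subsetP => u.
  by rewrite inE => /andP[/setDP[_ uF] _]; rewrite inE.
have cUh p : #|U p| <= 2 * h.
  case: (posnP h) => [h0|h0].
    rewrite h0 muln0; move: cF; rewrite h0 mul0n; apply: leq_trans.
    apply/subset_leq_card/subsetP => u.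
    by rewrite inE => /andP[/setDP[_ uF] _]; rewrite inE.
  have sU : U p \subset [set u in ~: F | f u == p.1] :|: [set u in ~: F | f u == p.2].
    apply/subsetP => u; rewrite inE => /andP[/setDP[_ uF] fu].
    by rewrite in_setU [X in X || _]inE [X in _ || X]inE inE uF.
  apply: leq_trans (subset_leq_card sU) _; apply: leq_trans (leq_card_setU _ _).1 _.
  by rewrite mul2n -addnn; apply: leq_add; apply: card_fibre.
have ct p : #|touching G (Y p) (U p) F| <= 6 * V.
  apply: touching_le => //.
  - exact: acyc_sub (sYS p) aS.
  - exact: subsetUr.
  - exact/setSU/subsetIl.
  - by move=> D aD cD; apply: expl => //; have := cUh p; lia.
have sS : S \subset ~: F :|: \bigcup_p touching G (Y p) (U p) F.
  apply/subsetP => x xS; rewrite in_setU inE; case: (boolP (x \in F)) => //= xF.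
  have [a [b [u [w [[ab xa xb aW bW] [uD wD hu hw]]]]]] := exists_hit mS xS xF.
  have fq v : v \in ~: S :\: F -> f v < q.
    case/setDP=> _ vF; have : index v (enum (~: F)) < q * h.
      by rewrite mulnC (leq_trans _ cF) // cardE index_mem mem_enum inE.
    rewrite /f; case: (posnP h) => [->|h0]; first by rewrite muln0.
    by rewrite ltn_divLR.
  pose p := (Ordinal (fq u uD), Ordinal (fq w wD)).
  have uU : u \in U p by rewrite inE uD /= eqxx.
  have wU : w \in U p by rewrite inE wD /= eqxx orbT.
  have sFY : F :&: ~: S \subset Y p by apply: subsetUl.
  have uY : u \in Y p by rewrite in_setU uU orbT.
  have wY : w \in Y p by rewrite in_setU wU orbT.
  have [aY cau] := hu _ sFY uY; have [bY cbw] := hw _ sFY wY.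
  apply/bigcupP; exists p => //; rewrite inE in_setD xF andbT; apply/andP; split.
    by apply/negP => /(subsetP (sYS p)); rewrite inE xS.
  apply/asboolP; exists a, b; split=> //; split; [by exists u|by exists w].
apply: leq_trans (subset_leq_card sS) _; apply: leq_trans (leq_card_setU _ _).1 _.
apply: leq_add => //; apply: leq_trans (card_bigcup_le ct) _.
by rewrite card_prod !card_ord; lia.
Qed.

(** The complement of [S] is maximal acyclic, so its acyclic superset adds nothing to it. *)
Lemma exact_approximation S : minimal_fvs G S -> explored (~: S) -> #|S| <= V.
Proof.
move=> /minimal_fvsP[_ maxS] [[W1 [a1 sS v1]] _]; apply: leq_trans v1.
apply/subset_leq_card/subsetP => v vS; rewrite inE; apply/negP => vW.
by apply: (maxS v vS); apply: acyc_sub a1; rewrite subUset sub1set vW.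
Qed.

End Approximation.

(** * Greedy extension of acyclic sets *)

Lemma den_put a x y m : den (PPut a x y) m = upd m a (eval m x) (eval m y).
Proof. by []. Qed.

Lemma den_seq p q m : den (PSeq p q) m = den q (den p m).
Proof. by []. Qed.

Lemma den_if x p q m : den (PIf x p q) m = if eval m x != 0 then den p m else den q m.
Proof. by []. Qed.

Lemma updE m a k v : upd m a k v a k = v.
Proof. by rewrite /upd !eqxx. Qed.

Lemma updNa m a k v b : b != a -> upd m a k v b = m b.
Proof. by move=> ba; apply: funext => j; rewrite /upd (negbTE ba). Qed.

Lemma updNk m a k v j : j != k -> upd m a k v a j = m a j.
Proof. by move=> jk; rewrite /upd (negbTE jk) andbF. Qed.

Definition PWhen x p := PIf x p PSkip.

Lemma den_when x p m : den (PWhen x p) m = if eval m x != 0 then den p m else m.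
Proof. by []. Qed.

(** Subtraction is truncated: two numbers agree when both differences vanish, and [bothE] is
    conjunction on arguments in {0, 1}. *)
Definition equalE x y := ESub (ECst 1) (EAdd (ESub x y) (ESub y x)).
Definition bothE x y := ESub (EAdd x y) (ECst 1).
Definition zeroE x := ESub (ECst 1) x.
Definition nonzeroE x := zeroE (zeroE x).

Lemma eval_equalE m x y : eval m (equalE x y) = (eval m x == eval m y).
Proof. by rewrite /=; lia. Qed.

Lemma eval_bothE m x y (b c : bool) : eval m x = b -> eval m y = c ->
  eval m (bothE x y) = b && c.
Proof. by move=> /= -> ->; case: b; case: c. Qed.

Lemma eval_zeroE m x : eval m (zeroE x) = (eval m x == 0).
Proof. by rewrite /=; lia. Qed.

Lemma eval_nonzeroE m x : eval m (nonzeroE x) = (eval m x != 0).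
Proof. by rewrite /=; lia. Qed.

Arguments den : simpl never.
Arguments upd : simpl never.

(* Array [vrow] holds the offsets i * n of the rows of the adjacency matrix,
   [vcur] the acyclic set under construction and [vcomp] its component labels. *)
Local Notation vrow := 3 (only parsing).
Local Notation vi := 4 (only parsing).
Local Notation vj := 5 (only parsing).
Local Notation va := 6 (only parsing).
Local Notation vmark := 7 (only parsing).
Local Notation vv := 8 (only parsing).
Local Notation vok := 9 (only parsing).
Local Notation vcur := 10 (only parsing).
Local Notation vcomp := 11 (only parsing).
Local Notation vW := 12 (only parsing).
Local Notation vF := 13 (only parsing).
Local Notation vbest := 14 (only parsing).
Local Notation vbestcnt := 15 (only parsing).
Local Notation vcnt := 16 (only parsing).
Local Notation vD := 17 (only parsing).
Local Notation vdeg := 18 (only parsing).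
Local Notation vM := 19 (only parsing).
Local Notation vcol := 20 (only parsing).
Local Notation vg := 21 (only parsing).
Local Notation vrem := 22 (only parsing).
Local Notation vquo := 23 (only parsing).
Local Notation vK := 24 (only parsing).
Local Notation vN := 25 (only parsing).
Local Notation vrho := 26 (only parsing).
Local Notation vrnd := 27 (only parsing).
Local Notation vp := 28 (only parsing).

Definition at_ (a x : nat) : expr := EGet a (varE x).
(** The row offset comes from a table because the machine cannot multiply. *)
Definition adjE x y := EGet 1 (EAdd (at_ vrow x) (varE y)).

(** For a candidate [v], [vmark] counts its neighbours in the current set by component label. It may
    enter exactly when no label occurs twice, and then all components hit receive the label [v]. *)
Definition clear_marks := PFor va 0 (PPut vmark (varE va) (ECst 0)).
Definition count_marks := PFor va 0 (PWhen (bothE (at_ vcur va) (adjE vv va))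
  (PPut vmark (at_ vcomp va) (EAdd (EGet vmark (at_ vcomp va)) (ECst 1)))).
Definition check_marks := PFor va 0 (PWhen (ESub (at_ vmark va) (ECst 1)) (PPut vok (ECst 0) (ECst 0))).
Definition relabel := PFor va 0 (PWhen (EGet vmark (at_ vcomp va)) (PPut vcomp (varE va) (varE vv))).
Definition insert_vertex :=
  PSeq relabel (PSeq (PPut vcomp (varE vv) (varE vv)) (PPut vcur (varE vv) (ECst 1))).
Definition try_vertex :=
  PSeq clear_marks (PSeq count_marks (PSeq (PPut vok (ECst 0) (ECst 1))
    (PSeq check_marks (PWhen (varE vok) insert_vertex)))).
Definition extend_pass x := PFor vv 0 (PWhen (bothE (zeroE (at_ vcur vv)) x) try_vertex).
(** The first pass secures [W] if it is acyclic, the second maximality. One scan per pass is enough: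
    the set only grows, so a rejected vertex stays rejected. *)
Definition extend := PSeq (PFor vv 0 (PPut vcur (varE vv) (ECst 0)))
  (PSeq (extend_pass (at_ vW vv)) (extend_pass (ECst 1))).

Section Extend.
Variables (n : nat) (G : sgraph 'I_n).
Implicit Types (m : memory) (C W : {set 'I_n}).

Definition env m := m 0 0 = n /\ forall i j : 'I_n, m 1 (m vrow i + j) = G i j.

Lemma env_eq m m' : m' 0 = m 0 -> m' 1 = m 1 -> m' vrow = m vrow -> env m -> env m'.
Proof. by rewrite /env => -> -> ->. Qed.

Definition stores m a C := forall i : 'I_n, m a i = (i \in C).

Lemma den_for_ord i p m (I : nat -> memory -> Prop) :
  m 0 0 = n -> i \notin writes p -> I 0 (upd m i 0 0) ->
  (forall (k : 'I_n) m', m' i 0 = k ->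
     (forall a, a \notin i :: writes p -> m' a = m a) ->
     I k m' -> I k.+1 (upd (den p m') i 0 k.+1)) ->
  I n (den (PFor i 0 p) m).
Proof.
move=> mn ip I0 IS; rewrite -mn; apply: den_for_ind => // k m'; rewrite mn => kn.
exact: (IS (Ordinal kn)).
Qed.

Lemma den_map v a e m (f : nat -> nat) : m 0 0 = n -> v != a ->
  (forall (k : 'I_n) m', m' v 0 = k ->
     (forall c, c != a -> c != v -> m' c = m c) -> eval m' e = f k) ->
  forall k : 'I_n, den (PFor v 0 (PPut a (varE v) e)) m a k = f k.
Proof.
move=> mn va fE k.
apply: (@den_for_ord v _ m (fun j m' => forall k : 'I_n, k < j -> m' a k = f k)) => //.
  by rewrite inE.
move=> j m' jv fr IH i; rewrite ltnS leq_eqVlt updNa 1?eq_sym // den_put /= jv.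
rewrite (fE j m' jv); last by move=> c ca cv; apply: fr; rewrite !inE (negbTE ca) (negbTE cv).
case/predU1P => [ij|ij]; first by rewrite (ord_inj ij) updE.
by rewrite updNk ?IH // ltn_eqF.
Qed.

Lemma evalS m a : eval m (varE a) = m a 0.
Proof. by []. Qed.

Lemma eval_at m a x : eval m (at_ a x) = m a (m x 0).
Proof. by []. Qed.

Lemma eval_adj m x y (i j : 'I_n) : env m -> m x 0 = i -> m y 0 = j ->
  eval m (adjE x y) = G i j.
Proof. by move=> [_ e] /= -> ->. Qed.

Lemma clear_marksE m : env m -> forall k : 'I_n, den clear_marks m vmark k = 0.
Proof. by move=> [mn _]; apply: (@den_map _ _ _ _ (fun=> 0)). Qed.

Lemma count_marksE m C (v : 'I_n) : env m -> m vv 0 = v -> stores m vcur C ->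
  (forall l : 'I_n, m vmark l = 0) ->
  forall l : 'I_n, den count_marks m vmark l
    = #|[set a in C | G v a & m vcomp a == l]|.
Proof.
move=> en mv mC m0 l.
have -> : [set a in C | G v a & m vcomp a == l]
    = [set a : 'I_n in C | [&& G v a, m vcomp a == l & a < n]].
  by apply/setP => a; rewrite !inE ltn_ord andbT.
apply: (@den_for_ord va _ m (fun j m' =>
  m' vmark l = #|[set a : 'I_n in C | [&& G v a, m vcomp a == l & a < j]]|)) => //.
- by case: en.
- rewrite updNa // m0; apply/esym/eqP; rewrite cards_eq0; apply/eqP/setP => a.
  by rewrite !inE ltn0 !andbF.
move=> k m' kv fr IH; rewrite updNa // /PWhen den_if.
have en' : env m' by apply: env_eq en; rewrite fr.
rewrite (@eval_bothE _ _ _ (k \in C) (G v k)); last first.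
- by apply: eval_adj en' _ kv; rewrite fr.
- by rewrite eval_at kv fr // mC.
set S := [set a : 'I_n in C | [&& G v a, m vcomp a == l & a < k]] in IH.
have -> : [set a : 'I_n in C | [&& G v a, m vcomp a == l & a < k.+1]]
    = if [&& k \in C, G v k & m vcomp k == l] then k |: S else S.
  apply/setP => a; have [->|ak] := eqVneq a k.
    by case: ifPn => [h|/negbTE h]; rewrite !inE ltnSn andbT h ?eqxx ?ltnn ?andbF.
  have e : (a < k.+1) = (a < k) by rewrite ltnS leq_eqVlt (inj_eq val_inj) (negbTE ak).
  by case: ifP; rewrite !inE e ?(negbTE ak).
have kS : k \notin S by rewrite !inE ltnn !andbF.
have ckE : eval m' (at_ vcomp va) = m vcomp k by rewrite eval_at kv fr.
rewrite eqb0 negbK andbA; case: (boolP (_ && _)) => /= [_|_]; last exact: IH.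
rewrite den_put ckE; case: eqVneq => [kl|kl].
  by rewrite kl updE cardsU1 kS /= kv (fr vcomp) // kl IH addn1.
by rewrite updNk ?IH // eq_sym.
Qed.

Lemma check_marksE m : env m -> m vok 0 = 1 ->
  den check_marks m vok 0 != 0 <-> (forall l : 'I_n, m vmark l <= 1).
Proof.
move=> [mn _] ok1; suff H : den check_marks m vok 0 != 0 <->
    (forall l : 'I_n, l < n -> m vmark l <= 1).
  by rewrite H; split=> h l; [apply: h | move=> _; apply: h].
apply: (@den_for_ord va _ m (fun j m' => m' vok 0 != 0 <->
   (forall l : 'I_n, l < j -> m vmark l <= 1))) => //.
  by rewrite updNa // ok1.
move=> k m' kv fr IH; rewrite updNa // /PWhen den_if /= kv fr // subn_eq0 -ltnNge.
have [k1|k1] := ltnP 1 (m vmark k).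
  rewrite den_put updE; split=> // h; by have := h k (ltnSn k); rewrite leqNgt k1.
rewrite -[den _ _]/m' IH; split=> h l; last by move=> lk; apply: h; apply: ltnW.
by rewrite ltnS leq_eqVlt => /predU1P[/ord_inj -> //|]; apply: h.
Qed.

(** Each label is overwritten at its own turn only and the marks do not change, so the loop acts as
    a simultaneous update. *)
Lemma relabelE m (v : 'I_n) : env m -> m vv 0 = v ->
  forall b : 'I_n, den relabel m vcomp b
    = if m vmark (m vcomp b) != 0 then val v else m vcomp b.
Proof.
move=> [mn _] mv b; have := ltn_ord b.
suff H : forall b : 'I_n, den relabel m vcomp b
    = if (b < n) && (m vmark (m vcomp b) != 0) then val v else m vcomp b.
  by rewrite H ltn_ord.
apply: (@den_for_ord va _ m (fun j m' => forall b : 'I_n, m' vcomp b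
    = if (b < j) && (m vmark (m vcomp b) != 0) then val v else m vcomp b)) => //.
move=> k m' kv fr IH c; rewrite updNa // /PWhen den_if /= kv (fr vmark) // IH ltnn /=.
case: ifPn => [mk|mk].
  rewrite den_put /= kv (fr vv) // mv; have [->|ck] := eqVneq c k.
    by rewrite updE ltnSn mk.
  rewrite updNk ?(inj_eq val_inj) // IH ltnS [c <= k]leq_eqVlt.
  by rewrite (inj_eq val_inj) (negbTE ck).
rewrite -[den _ _]/m' IH ltnS [c <= k]leq_eqVlt (inj_eq val_inj).
by have [->|ck] := eqVneq c k; rewrite ?ltnn ?(negbTE mk) ?andbF.
Qed.

(** Labels are taken among the vertices of [C], which makes a vertex outside [C] a fresh label. *)
Definition comp_labels m C : Prop :=
  (forall a : 'I_n, a \in C -> exists2 c : 'I_n, c \in C & m vcomp a = c) /\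
  (forall a b : 'I_n, a \in C -> b \in C -> (m vcomp a == m vcomp b) = conn G C a b).

Definition forest_state m C := [/\ stores m vcur C, acyc G C & comp_labels m C].

Lemma conn_setU1 C v a : v \notin C -> a \in C ->
  conn G (v |: C) a v <-> (exists b, [/\ b \in C, G v b & conn G C a b]).
Proof.
move=> vC aC; have av : a \notin [set v] by rewrite in_set1; apply: contraNneq vC => <-.
have eC : (v |: C) :\: [set v] = C by apply: setU1K.
split=> [c|[b [bC vb ab]]].
  have [|l [e [+ + ev le]]] := first_hit c _ av (set11 v); first by rewrite in_setU1 aC orbT.
  rewrite eC => lC al; exists l; split=> //.
  by rewrite adj_sym; move: le; rewrite (set1P ev).
apply: (connect_trans (conn_mono (subsetUr _ _) ab)); apply: conn_edge.
- by rewrite in_setU1 bC orbT.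
- exact: setU11.
- by rewrite adj_sym.
Qed.

Lemma conn_setU1_cases C v a b : v \notin C -> a \in C -> b \in C ->
  conn G (v |: C) a b ->
  conn G C a b \/ (conn G (v |: C) a v /\ conn G (v |: C) b v).
Proof.
move=> vC aC bC c; have [|h|[s [sv sC sa sb]]] := conn_inside_or_meets C c.
- by rewrite in_setU1 aC orbT.
- by left; apply: conn_mono h; apply: subsetIr.
- by right; move: sv; rewrite in_setU1 (negbTE sC) orbF => /eqP e; rewrite -{2 4}e.
Qed.

Lemma insert_vertexE m C (v : 'I_n) : env m -> m vv 0 = v -> v \notin C ->
  forest_state m C -> acyc G (v |: C) ->
  (forall l : 'I_n, m vmark l = #|[set a in C | G v a & m vcomp a == l]|) ->
  forest_state (den insert_vertex m) (v |: C).
Proof.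
move=> en mv vC [mC aC [lab1 lab2]] aCv mk.
have fr a : a \notin writes relabel -> den relabel m a = m a by apply: den_frame.
(* The marked labels are exactly those of the components that [v] joins. *)
have mk0 b : b \in C -> (m vmark (m vcomp b) != 0) = conn G (v |: C) b v.
  move=> bC; have [l lC bl] := lab1 b bC; rewrite bl mk -lt0n; apply/card_gt0P/idP.
    move=> [a]; rewrite !inE => /and3P[aC' va al].
    apply/(conn_setU1 vC bC); exists a; split=> //.
    by rewrite -lab2 // bl eq_sym.
  move/(conn_setU1 vC bC) => [a [aC' va ba]]; exists a; rewrite !inE aC' va /=.
  by rewrite -bl eq_sym lab2.
set m' := den insert_vertex m.
have em' : m' = upd (upd (den relabel m) vcomp v v) vcur v 1.
  rewrite /m' /insert_vertex !den_seq !den_put.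
  have -> : eval (den relabel m) (varE vv) = v by rewrite evalS fr.
  by rewrite evalS updNa // fr // mv.
have cur a : m' vcur a = if a == v then 1 else m vcur a.
  rewrite em'; case: eqVneq => [->|av]; first by rewrite updE.
  by rewrite updNk // updNa // fr.
have cmp (a : 'I_n) : m' vcomp a = if a == v then val v else
    if m vmark (m vcomp a) != 0 then val v else m vcomp a.
  rewrite em' updNa //; case: eqVneq => [->|av]; first by rewrite updE.
  by rewrite updNk ?(inj_eq val_inj) // (relabelE en mv).
have cmpC a : a \in C -> m' vcomp a = if conn G (v |: C) a v then val v else m vcomp a.
  by move=> aC'; rewrite cmp mk0 //; case: eqVneq => // av; rewrite -av aC' in vC.
split=> //.
  move=> a; rewrite cur in_setU1 -(inj_eq val_inj) /=.
  by case: eqP => //= _; rewrite mC.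
have cmpv : m' vcomp v = v by rewrite cmp eqxx.
(* The label [v] is fresh, so components not adjacent to [v] keep labels different from it. *)
have nv a : a \in C -> (m vcomp a == v) = false.
  move=> aC'; have [l lC ->] := lab1 a aC'.
  by apply/negbTE; apply: contraNneq vC => /ord_inj <-.
have cs := within_sym G (v |: C); have ct := @connect_trans _ (within G (v |: C)).
split=> [a|a b]; rewrite !in_setU1.
  move=> /predU1P[->|aC']; first by exists v; rewrite ?setU11.
  rewrite cmpC //; case: ifP => _; first by exists v; rewrite ?setU11.
  by have [l lC al] := lab1 a aC'; exists l => //; rewrite in_setU1 lC orbT.
move=> /predU1P[->|aC'] /predU1P[->|bC].
- by rewrite eqxx /conn connect0.
- rewrite cmpv cmpC // /conn cs -/(conn G (v |: C) b v).
  by case: ifP => // _; [rewrite eqxx | rewrite eq_sym nv].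
- rewrite cmpv cmpC //.
  by case: ifP => // _; [rewrite eqxx | rewrite nv].
rewrite !cmpC //; case: ifPn => av; case: ifPn => bv.
- by rewrite eqxx; apply/esym/(ct v) => //; rewrite cs.
- rewrite eq_sym nv //; apply/esym/negbTE; apply: contra bv => ab.
  by apply: ct av; rewrite cs.
- rewrite nv //; apply/esym/negbTE; apply: contra av => ab.
  exact: ct bv.
rewrite lab2 //; apply/idP/idP; first by apply: conn_mono; apply: subsetUr.
by move=> /(conn_setU1_cases vC aC' bC)[//|[h _]]; rewrite h in av.
Qed.

Lemma marks_le1 m C (v : 'I_n) : v \notin C -> forest_state m C ->
  (forall l : 'I_n, #|[set a in C | G v a & m vcomp a == l]| <= 1) <-> acyc G (v |: C).
Proof.
move=> vC [_ aC [lab1 lab2]]; rewrite (acyc_setU1P aC vC); split=> [h a b aC' bC ab va vb|h l].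
  apply/negP; rewrite -lab2 // => /eqP e; have [l lC bl] := lab1 b bC.
  have := h l; rewrite leqNgt => /negP; apply; apply/card_gt1P; exists a, b.
  by rewrite !inE aC' bC va vb e bl eqxx.
rewrite leqNgt; apply/negP => /card_gt1P[a [b []]]; rewrite !inE.
move=> /and3P[aC' va /eqP al] /and3P[bC vb /eqP bl] ab.
by move: (h a b aC' bC ab va vb); rewrite -lab2 // al bl eqxx.
Qed.

Lemma try_vertexE m C (v : 'I_n) : env m -> m vv 0 = v -> v \notin C ->
  forest_state m C -> exists2 C', forest_state (den try_vertex m) C' &
    (acyc G (v |: C) /\ C' = v |: C) \/ (~ acyc G (v |: C) /\ C' = C).
Proof.
move=> en mv vC fs; rewrite /try_vertex den_seq.
set m1 := den clear_marks m.
have fr1 a : a \notin writes clear_marks -> m1 a = m a by apply: den_frame.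
have en1 : env m1 by apply: env_eq en; rewrite fr1.
rewrite den_seq; set m2 := den count_marks m1.
have fr2 a : a \notin writes count_marks -> m2 a = m a.
  by move=> h; rewrite /m2 den_frame // fr1.
rewrite den_seq den_put /=; set m3 := upd _ _ _ _.
have fr3 a : a \notin vok :: writes count_marks -> m3 a = m a.
  by rewrite inE negb_or => /andP[h1 h2]; rewrite /m3 updNa // fr2.
have en3 : env m3 by apply: env_eq en; rewrite fr3.
have mk3 l : l < n -> m3 vmark l = #|[set a in C | G v a & m vcomp a == l]|.
  move=> ln; rewrite /m3 updNa // /m2.
  have [mC _ _] := fs.
  have mv1 : m1 vv 0 = v by rewrite fr1.
  have mC1 : stores m1 vcur C by move=> a; rewrite fr1 // mC.
  by rewrite (count_marksE en1 mv1 mC1 (clear_marksE en) (Ordinal ln)) (fr1 vcomp).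
rewrite den_seq; set m4 := den check_marks m3.
have fr4 a : a \notin vok :: writes count_marks -> m4 a = m a.
  move=> h; rewrite /m4 den_frame ?fr3 //; apply: contra h.
  by rewrite !inE => /orP[]/eqP ->.
have en4 : env m4 by apply: env_eq en; rewrite fr4.
have mk4 (l : 'I_n) : m4 vmark l = #|[set a in C | G v a & m4 vcomp a == l]|.
  by rewrite (fr4 vcomp) // /m4 den_frame // mk3.
have fs4 : forest_state m4 C.
  have [mC aC [l1 l2]] := fs; split=> //; first by move=> a; rewrite fr4.
  by split=> [a|a b]; rewrite !fr4 //; [apply: l1 | apply: l2].
have ok4 : m4 vok 0 != 0 <-> acyc G (v |: C).
  rewrite (check_marksE en3 (updE _ _ _ _)) -(marks_le1 vC fs4).
  by split=> h l; move: (h l); rewrite -mk4 /m4 [den _ m3 vmark]den_frame.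
rewrite /PWhen den_if evalS; case: ifPn => [|/negP] ok.
  have ac := ok4.1 ok; exists (v |: C); last by left.
  by apply: insert_vertexE => //; rewrite fr4.
by exists C => //; right; split=> // /ok4.
Qed.

Lemma extend_passE m C x (X : {set 'I_n}) : env m -> forest_state m C ->
  (forall m' (v : 'I_n), m' vv 0 = v -> m' vW = m vW -> eval m' x = (v \in X)) ->
  exists C', [/\ forest_state (den (extend_pass x) m) C', C \subset C',
    C' \subset C :|: X & forall v, v \in X -> v \in C' \/ ~ acyc G (v |: C')].
Proof.
move=> en fs xX.
suff [C' [fs' sC sX h]] : exists C', [/\ forest_state (den (extend_pass x) m) C', C \subset C',
    C' \subset C :|: X & forall v : 'I_n, v < n -> v \in X -> v \in C' \/ ~ acyc G (v |: C')].
  by exists C'; split=> // v vX; apply: h.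
apply: (@den_for_ord vv _ m (fun j m' => exists C', [/\ forest_state m' C', C \subset C',
    C' \subset C :|: X & forall v : 'I_n, v < j -> v \in X -> v \in C' \/ ~ acyc G (v |: C')])) => //.
- by case: en.
- by exists C; split; rewrite ?subsetUl.
move=> v m' vm' fr [C' [fs' sC sX h]].
have [mC _ _] := fs'.
have en' : env m' by apply: env_eq en; rewrite fr.
have fsU m1 C1 : forest_state m1 C1 -> forest_state (upd m1 vv 0 v.+1) C1.
  by move=> fs1; exact: fs1.
rewrite /PWhen den_if (@eval_bothE _ _ _ (v \notin C') (v \in X)); last first.
- by apply: xX => //; apply: fr.
- by rewrite eval_zeroE eval_at vm' mC eqb0.
rewrite eqb0 negbK; case: (boolP (_ && _)) => [/andP[vC vX]|vCX].
  have [C2 fs2 c2] := try_vertexE en' vm' vC fs'; exists C2.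
  have sC2 : C' \subset C2.
    by case: c2 => -[_ ->] //; apply: subsetUr.
  split; [exact: fsU|exact: subset_trans sC sC2| |].
    by case: c2 => -[_ ->] //; rewrite subUset sX sub1set in_setU vX orbT.
  move=> w; rewrite ltnS leq_eqVlt => /predU1P[/ord_inj ->|wv] wX.
    case: c2 => -[ac ->]; first by left; apply: setU11.
    by right.
  have [wC|wC] := h w wv wX; [left; exact: (subsetP sC2)|right=> aw; apply: wC].
  by apply: acyc_sub aw; apply: setUS.
exists C'; split=> //.
move=> w; rewrite ltnS leq_eqVlt => /predU1P[/ord_inj ->|]; last exact: h.
by move=> vX; left; move: vCX; rewrite vX andbT negbK.
Qed.

Definition maximal_acyc C := acyc G C /\ forall v, v \notin C -> ~ acyc G (v |: C).

Lemma extendE m W : env m -> stores m vW W ->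
  exists C, [/\ stores (den extend m) vcur C, maximal_acyc C & acyc G W -> W \subset C].
Proof.
move=> en mW; rewrite /extend den_seq; set m1 := den _ m.
have fr1 a : a != vv -> a != vcur -> m1 a = m a.
  by move=> h1 h2; apply: den_frame; rewrite !inE negb_or h1.
have en1 : env m1 by apply: env_eq en; rewrite fr1.
have fs1 : forest_state m1 set0.
  split; last by split=> [a|a b]; rewrite inE.
    move=> i; rewrite inE; apply: (@den_map _ _ _ _ (fun=> 0)) => //; by case: en.
  by move=> c c2 _ h; case: c c2 h => // a c _ /(_ a (mem_head _ _)); rewrite inE.
rewrite den_seq.
have [|C1 [fs2 _ sC1 h1]] := @extend_passE m1 set0 (at_ vW vv) W en1 fs1.
  by move=> m' v mv mw; rewrite eval_at mv mw fr1.
move: fs2; set m2 := den _ m1 => fs2.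
have en2 : env m2 by apply: env_eq en1; rewrite /m2 den_frame.
have [|C2 [fs3 sC2 _ h2]] := @extend_passE m2 C1 (ECst 1) setT en2 fs2.
  by move=> m' v _ _; rewrite inE.
exists C2; have [mC2 aC2 _] := fs3; split=> //.
  by split=> // v vC; have [vC2|//] := h2 v (in_setT v); rewrite vC2 in vC.
move=> aW; apply: subset_trans sC2; apply/subsetP => v vW; have [//|] := h1 v vW.
case; apply: acyc_sub aW; rewrite subUset sub1set vW /=.
by move: sC1; rewrite set0U.
Qed.

End Extend.

(** * The two-colouring as a program *)

Definition propagate_step :=
  PWhen (bothE (adjE vp vv) (bothE (nonzeroE (at_ vcol vp))
          (bothE (at_ vM vv) (equalE (at_ vcol vv) (ECst 0)))))
    (PIf (at_ vdeg vv) (PPut vcol (varE vv) (ESub (ECst 3) (at_ vcol vp)))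
                       (PPut vcol (varE vv) (at_ vcol vp))).
Definition propagate := PFor vp 0 (PFor vv 0 propagate_step).
Definition rounds := PFor vrnd 0 propagate.
(** A labelled vertex that is still uncoloured becomes a root, and its tree is completed before the
    next one is sought. Trees without labelled vertices stay uncoloured. *)
Definition colour_loop := PFor vrho 0
  (PSeq (PWhen (bothE (at_ vM vrho) (bothE (equalE (at_ vdeg vrho) (ECst 1)) (equalE (at_ vcol vrho) (ECst 0))))
          (PPut vcol (varE vrho) (ECst 1)))
        rounds).
Definition count_degrees := PFor vv 0 (PSeq (PPut vdeg (varE vv) (ECst 0))
  (PFor va 0 (PWhen (bothE (at_ vD va) (adjE vv va))
    (PPut vdeg (varE vv) (EAdd (at_ vdeg vv) (ECst 1)))))).
Definition compute_middle := PFor vv 0 (PPut vM (varE vv)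
  (ESub (ESub (at_ vF vv) (at_ vD vv)) (ESub (at_ vdeg vv) (ECst 1)))).
Definition clear_colours := PFor vv 0 (PPut vcol (varE vv) (ECst 0)).
Definition colour := PSeq count_degrees (PSeq compute_middle (PSeq clear_colours colour_loop)).

Section Colour.
Variables (n : nat) (G : sgraph 'I_n).
Implicit Types (m : memory) (C W B : {set 'I_n}).
Local Notation env := (env G).

Lemma count_degreesE m D : env m -> stores m vD D ->
  forall v : 'I_n, den count_degrees m vdeg v = deg_in G D v.
Proof.
move=> en mD; have mn : m 0 0 = n by case: en.
suff H : forall v : 'I_n, v < n -> den count_degrees m vdeg v = deg_in G D v.
  by move=> v; apply: H.
apply: (@den_for_ord n vv _ m (fun k m' => forall v : 'I_n, v < k -> m' vdeg v = deg_in G D v)) => //.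
move=> v m' vm' fr IH w; rewrite updNa // den_seq den_put evalS vm'.
set m1 := upd _ _ _ _; set q := PFor _ _ _.
have en1 : env m1 by apply: env_eq en; rewrite /m1 updNa // fr.
have mn1 : m1 0 0 = n by case: en1.
have : den q m1 vdeg v = #|[set d : 'I_n in D | G v d & d < n]| /\
       forall w : 'I_n, w != v -> den q m1 vdeg w = m1 vdeg w.
  apply: (@den_for_ord n va _ m1 (fun k m2 =>
    m2 vdeg v = #|[set d : 'I_n in D | G v d & d < k]| /\
    forall w : 'I_n, w != v -> m2 vdeg w = m1 vdeg w)) => //.
    rewrite /m1 updNa // updE; split=> //; apply/esym/eqP; rewrite cards_eq0.
    by apply/eqP/setP => d; rewrite !inE ltn0 !andbF.
  move=> k m2 km2 fr2 [IH1 IH2]; rewrite !updNa // /PWhen den_if.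
  have vm2 : m2 vv 0 = v by rewrite fr2 // /m1 updNa.
  have en2 : env m2 by apply: env_eq en1; rewrite fr2.
  rewrite (@eval_bothE _ _ _ (k \in D) (G v k)); last first.
  - exact: (eval_adj en2 vm2 km2).
  - by rewrite eval_at km2 fr2 // /m1 updNa // fr // mD.
  set S := [set d : 'I_n in D | G v d & d < k] in IH1.
  have -> : [set d : 'I_n in D | G v d & d < k.+1]
      = if (k \in D) && G v k then k |: S else S.
    apply/setP => a; have [->|ak] := eqVneq a k.
      by case: ifPn => [h|/negbTE h]; rewrite !inE ltnSn andbT h ?eqxx ?ltnn ?andbF.
    have e : (a < k.+1) = (a < k) by rewrite ltnS leq_eqVlt (inj_eq val_inj) (negbTE ak).
    by case: ifP; rewrite !inE e ?(negbTE ak).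
  have kS : k \notin S by rewrite !inE ltnn !andbF.
  rewrite eqb0 negbK; case: (boolP (_ && _)) => /= [_|_]; last by split.
  rewrite den_put evalS vm2 updE; split; last first.
    by move=> u uv; rewrite updNk ?(inj_eq val_inj) // IH2.
  by rewrite /= vm2 IH1 cardsU1 kS addn1.
move=> [h1 h2]; rewrite ltnS leq_eqVlt => /predU1P[/ord_inj ->|wv].
  rewrite h1 /deg_in; congr #|pred_of_set _|; apply/setP => d.
  by rewrite !inE ltn_ord andbT.
rewrite h2 ?(inj_eq val_inj) ?neq_ltn ?wv // /m1 updNk ?(ltn_eqF wv) //.
exact: IH.
Qed.

Section Rounds.
Variables (F D : {set 'I_n}).
Hypotheses (aF : acyc G F) (aD : acyc G D).
Local Notation M := (middle G F D).
Local Notation L := (labelled G F D).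

Definition colour_env m :=
  [/\ env m, stores m vM M & forall v : 'I_n, m vdeg v = deg_in G D v].

Definition col_of m : 'I_n -> nat := fun i => m vcol i.

Lemma colour_env_eq m m' : (forall a, a \in [:: 0; 1; vrow; vM; vdeg] -> m' a = m a) ->
  colour_env m -> colour_env m'.
Proof.
move=> e [en mM md]; split.
- by apply: env_eq en; rewrite e.
- by move=> i; rewrite e.
- by move=> i; rewrite e.
Qed.

(** Propagation creates no roots, hence the same [R] on both sides. The last clause makes
    closedness, once reached, survive the remaining sweeps. *)
Definition refines (col col' : 'I_n -> nat) :=
  [/\ forall R, colouring G F D col R -> colouring G F D col' R,
      forall w, col w != 0 -> col' w = col w &
      col_closed G F D col -> col' = col].

Lemma refines_trans col1 col2 col3 :
  refines col1 col2 -> refines col2 col3 -> refines col1 col3.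
Proof.
move=> [a1 a2 a3] [b1 b2 b3]; split=> [R /a1/b1 //|w w0|cl].
  by rewrite b2 a2.
by rewrite b3 a3.
Qed.

Lemma refines_sub col col' : refines col col' -> coloured col \subset coloured col'.
Proof. by move=> [_ h _]; apply/subsetP => w; rewrite !inE => w0; rewrite h. Qed.

Lemma in_labelled v : v \in M -> (v \in L) = (deg_in G D v != 0).
Proof.
by move=> vM; rewrite inE vM /=; move: vM; rewrite inE => /andP[_]; case: deg_in => [|[]].
Qed.

Lemma propagate_stepE m (p v : 'I_n) R0 : colouring G F D (col_of m) R0 ->
  colour_env m -> m vp 0 = p -> m vv 0 = v ->
  refines (col_of m) (col_of (den propagate_step m)) /\
  (p \in coloured (col_of m) -> v \in M -> G p v ->
     v \in coloured (col_of (den propagate_step m))).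
Proof.
move=> cR0 [en mM md] mp mv; rewrite /propagate_step /PWhen den_if.
rewrite (@eval_bothE _ _ _ (G p v) [&& col_of m p != 0, v \in M & col_of m v == 0]); last first.
- apply: eval_bothE; first by rewrite eval_nonzeroE eval_at mp.
  apply: eval_bothE; first by rewrite eval_at mv mM.
  by rewrite eval_equalE eval_at mv.
- exact: (eval_adj en mp mv).
rewrite eqb0 negbK; case: ifPn => [/and4P[pv p0 vM v0]|h]; last first.
  split=> // pC vM pv; rewrite inE; apply: contra h => v0; rewrite pv vM v0 /= andbT.
  by move: pC; rewrite inE => ->.
set m' := den _ _.
have em : m' = upd m vcol v (if v \in L then 3 - col_of m p else col_of m p).
  rewrite /m' den_if eval_at mv md -in_labelled //.
  by case: ifP => _; rewrite den_put evalS mv /= mp.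
have c1 : col_of m' v = (if v \in L then 3 - col_of m p else col_of m p).
  by rewrite /col_of em updE.
have same w : w != v -> col_of m' w = col_of m w.
  by move=> wv; rewrite /col_of em updNk.
have pC : p \in coloured (col_of m) by rewrite inE.
have e0 : col_of m v = 0 by apply/eqP.
have vp_ : G v p by rewrite adj_sym.
have v1 : col_of m' v != 0.
  rewrite c1; case: ifP => // _.
  by have := col_le2 cR0 p; lia.
split; last by move=> _ _ _; rewrite inE.
split.
- by move=> R cR; apply: (colouring_child aF e0 same v1 cR pC vM vp_ c1).
- by move=> w w0; apply: same; apply: contraNneq w0 => ->; rewrite e0.
- move=> cl; have := cl p v pC vM pv; by rewrite inE e0.
Qed.

Lemma propagateE m R : colouring G F D (col_of m) R -> colour_env m ->
  refines (col_of m) (col_of (den propagate m)) /\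
  (forall p v, p \in coloured (col_of m) -> v \in M -> G p v ->
     v \in coloured (col_of (den propagate m))).
Proof.
move=> cR ce; have mn : m 0 0 = n by case: ce => -[].
suff [h1 h2] : refines (col_of m) (col_of (den propagate m)) /\
  (forall p v : 'I_n, p < n -> p \in coloured (col_of m) -> v \in M -> G p v ->
     v \in coloured (col_of (den propagate m))).
  by split=> // p v; apply: h2.
apply: (@den_for_ord n vp _ m (fun k m1 => refines (col_of m) (col_of m1) /\
  (forall p v : 'I_n, p < k -> p \in coloured (col_of m) -> v \in M -> G p v ->
     v \in coloured (col_of m1)))) => // p m1 pm1 fr1 [r1 IH1].
have mn1 : m1 0 0 = n by rewrite fr1.
set q := PFor _ _ _.
suff [h1 h2] : refines (col_of m1) (col_of (den q m1)) /\
  (forall v : 'I_n, v < n -> p \in coloured (col_of m) -> v \in M -> G p v ->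
     v \in coloured (col_of (den q m1))).
  split; first exact: refines_trans h1.
  move=> u v; rewrite ltnS leq_eqVlt => /predU1P[/ord_inj ->|uk uC vM uv]; first exact: h2.
  by apply: (subsetP (refines_sub h1)); apply: IH1 uv.
apply: (@den_for_ord n vv _ m1 (fun k m2 => refines (col_of m1) (col_of m2) /\
  (forall v : 'I_n, v < k -> p \in coloured (col_of m) -> v \in M -> G p v ->
     v \in coloured (col_of m2)))) => // v m2 vm2 fr2 [r2 IH2].
have ce2 : colour_env m2.
  by apply: colour_env_eq ce => a; rewrite !inE => /or4P[|||/orP[]] /eqP->; rewrite fr2 ?fr1.
have pm2 : m2 vp 0 = p by rewrite fr2.
have cR2 : colouring G F D (col_of m2) R.
  by have [h _ _] := r2; apply: h; have [h _ _] := r1; apply: h.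
have [r3 h3] := propagate_stepE cR2 ce2 pm2 vm2.
split; first exact: refines_trans r2 r3.
move=> w; rewrite ltnS leq_eqVlt => /predU1P[/ord_inj -> pC wM pw|wk pC wM pw].
  by apply: h3 => //; apply: (subsetP (refines_sub r2)); apply: (subsetP (refines_sub r1)).
by apply: (subsetP (refines_sub r3)); apply: IH2.
Qed.

(** A sweep that starts from a colouring that is not closed colours a new vertex. After [n] sweeps
    either closedness has occurred or all vertices are coloured, which is closed too. *)
Lemma roundsE m R : colouring G F D (col_of m) R -> colour_env m ->
  refines (col_of m) (col_of (den rounds m)) /\
  col_closed G F D (col_of (den rounds m)).
Proof.
move=> cR ce; have mn : m 0 0 = n by case: ce => -[].
suff [h1 h2] : refines (col_of m) (col_of (den rounds m)) /\
  (col_closed G F D (col_of (den rounds m)) \/ n <= #|coloured (col_of (den rounds m))|).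
  split=> //; case: h2 => // nC p v _ _ _.
  have -> : coloured (col_of (den rounds m)) = setT; last by rewrite inE.
  by apply/eqP; rewrite eqEcard subsetT cardsT card_ord.
apply: (@den_for_ord n vrnd _ m (fun k m1 => refines (col_of m) (col_of m1) /\
  (col_closed G F D (col_of m1) \/ k <= #|coloured (col_of m1)|))) => //.
  by split=> //; right.
move=> k m1 km1 fr1 [r1 IH]; rewrite -[col_of (upd _ _ _ _)]/(col_of (den propagate m1)).
have cR1 : colouring G F D (col_of m1) R by have [h _ _] := r1; apply: h.
have ce1 : colour_env m1.
  by apply: colour_env_eq ce => a; rewrite !inE => /or4P[|||/orP[]] /eqP->; rewrite fr1.
have [r2 h2] := propagateE cR1 ce1.
split; first exact: refines_trans r1 r2.
have [cl|ncl] := pselect (col_closed G F D (col_of m1)).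
  by left; have [_ _ ->] := r2.
right; case: IH => // kC; apply: leq_ltn_trans kC _; apply: proper_card.
apply/properP; split; first exact: refines_sub.
apply: contrapT => no; apply: ncl => p v pC vM pv.
by apply: contrapT => /negP nv; apply: no; exists v => //; apply: h2 pv.
Qed.

Lemma colour_loopE m : colour_env m -> (forall v : 'I_n, m vcol v = 0) ->
  exists2 R, colouring G F D (col_of (den colour_loop m)) R &
    L \subset coloured (col_of (den colour_loop m)).
Proof.
move=> ce m0; have mn : m 0 0 = n by case: ce => -[].
suff [R [cR _ h]] : exists R, [/\ colouring G F D (col_of (den colour_loop m)) R,
    col_closed G F D (col_of (den colour_loop m)) &
    forall v : 'I_n, v < n -> v \in L -> v \in coloured (col_of (den colour_loop m))].
  by exists R => //; apply/subsetP => v; apply: h.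
apply: (@den_for_ord n vrho _ m (fun k m1 => exists R, [/\ colouring G F D (col_of m1) R,
    col_closed G F D (col_of m1) &
    forall v : 'I_n, v < k -> v \in L -> v \in coloured (col_of m1)])) => //.
  have -> : col_of (upd m vrho 0 0) = (fun=> 0) by apply: funext => v; apply: m0.
  by exists set0; split=> //; [apply: colouring0 | move=> p v; rewrite inE].
move=> k m1 km1 fr1 [R [cR cl IH]]; rewrite den_seq; set m2 := den _ m1.
rewrite -[col_of (upd _ _ _ _)]/(col_of (den rounds m2)).
have ce1 : colour_env m1.
  by apply: colour_env_eq ce => a; rewrite !inE => /or4P[|||/orP[]] /eqP->; rewrite fr1.
have ce2 : colour_env m2.
  by apply: colour_env_eq ce1 => a; rewrite !inE => /or4P[|||/orP[]] /eqP->; apply: den_frame.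
suff [R' cR' h] : exists2 R', colouring G F D (col_of m2) R' &
    forall v : 'I_n, v < k.+1 -> v \in L -> v \in coloured (col_of m2).
  have [r3 cl3] := roundsE cR' ce2; exists R'; split=> //.
    by have [h' _ _] := r3; apply: h'.
  by move=> v vk vL; apply: (subsetP (refines_sub r3)); apply: h.
have {ce1} [en mM md] := ce1.
rewrite /m2 /PWhen den_if (@eval_bothE _ _ _ (k \in M) ((deg_in G D k == 1) && (col_of m1 k == 0))); last first.
- apply: eval_bothE; first by rewrite eval_equalE eval_at km1 md.
  by rewrite eval_equalE eval_at km1.
- by rewrite eval_at km1 mM.
rewrite eqb0 negbK andbA; have -> : (k \in M) && (deg_in G D k == 1) = (k \in L) by rewrite [RHS]inE.
case: ifPn => [/andP[kL /eqP k0]|h].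
  rewrite den_put evalS km1 /=; set m3 := upd _ _ _ _.
  have c1 : col_of m3 k = 1 by rewrite /col_of /m3 updE.
  have same w : w != k -> col_of m3 w = col_of m1 w by move=> wk; rewrite /col_of /m3 updNk.
  have c10 : col_of m3 k != 0 by rewrite c1.
  exists (k |: R); first exact: (colouring_root k0 same c10 cR cl kL c1).
  move=> v; rewrite ltnS leq_eqVlt => /predU1P[/ord_inj -> _|vk vL]; first by rewrite inE.
  by rewrite (coloured_step same c10) in_setU1 IH ?orbT.
exists R => // v; rewrite ltnS leq_eqVlt => /predU1P[/ord_inj -> kL|]; last exact: IH.
by rewrite inE; apply: contra h => ->; rewrite kL.
Qed.

End Rounds.

Lemma colourE m F D : env m -> acyc G F -> acyc G D ->
  stores m vF F -> stores m vD D ->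
  exists2 R, colouring G F D (col_of (den colour m)) R &
    labelled G F D \subset coloured (col_of (den colour m)).
Proof.
move=> en aF aD mF mD; rewrite /colour den_seq; set m1 := den _ m.
have fr1 a : a \notin writes count_degrees -> m1 a = m a by apply: den_frame.
have en1 : env m1 by apply: env_eq en; rewrite fr1.
have d1 : forall v : 'I_n, m1 vdeg v = deg_in G D v by apply: count_degreesE.
rewrite den_seq; set m2 := den _ m1.
have fr2 a : a \notin writes compute_middle -> m2 a = m1 a by apply: den_frame.
have en2 : env m2 by apply: env_eq en1; rewrite fr2.
have M2 : stores m2 vM (middle G F D).
  have mn1 : m1 0 0 = n by case: en1.
  move=> v; rewrite /m2 (@den_map n vv vM _ m1 (fun k => (m1 vF k - m1 vD k) - (m1 vdeg k - 1))) //.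
    rewrite d1 !fr1 // mF mD !inE.
    by case: (v \in F); case: (v \in D); case: deg_in => [|[|?]].
  by move=> k m' km' fr; rewrite /= km' !fr.
rewrite den_seq; set m3 := den _ m2.
have fr3 a : a \notin writes clear_colours -> m3 a = m2 a by apply: den_frame.
have en3 : env m3 by apply: env_eq en2; rewrite fr3.
apply: colour_loopE => //.
  split=> // [v|v]; first by rewrite fr3 // M2.
  by rewrite fr3 // fr2 // d1.
have mn2 : m2 0 0 = n by case: en2.
by apply: (@den_map n vv vcol _ m2 (fun=> 0)).
Qed.

End Colour.

(** * Enumeration *)

Definition count_current := PSeq (PPut vcnt (ECst 0) (ECst 0))
  (PFor vi 0 (PPut vcnt (ECst 0) (EAdd (varE vcnt) (at_ vcur vi)))).
Definition keep_current := PSeq (PPut vbestcnt (ECst 0) (varE vcnt))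
  (PFor vi 0 (PPut vbest (varE vi) (at_ vcur vi))).
(** The smallest maximal acyclic set is kept, its complement being the largest solution. *)
Definition consider := PSeq count_current
  (PWhen (ESub (varE vbestcnt) (varE vcnt)) keep_current).
Definition divide_step := PSeq (PPut vrem (ECst 0) (ESub (varE vrem) (EAdd (varE 0) (ECst 1))))
  (PPut vquo (ECst 0) (EAdd (varE vquo) (ECst 1))).
(** Division by n + 1 through repeated subtraction. The loop runs [vN] times, which exceeds any
    quotient, and idles once the remainder is reached. *)
Definition divide := PSeq (PPut vquo (ECst 0) (ECst 0))
  (PFor vi vN (PWhen (ESub (varE vrem) (varE 0)) divide_step)).
(** The padding digit n sets cell n of [vD], outside the range of the vertices. *)
Definition decode := PSeq (PFor vi 0 (PPut vD (varE vi) (ECst 0)))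
  (PSeq (PPut vrem (ECst 0) (varE vg))
    (PFor vj vK (PSeq divide
      (PSeq (PPut vD (varE vrem) (ECst 1)) (PPut vrem (ECst 0) (varE vquo)))))).
Definition try_colour c := PSeq
  (PFor vv 0 (PPut vW (varE vv) (nonzeroE (EAdd (at_ vD vv) (equalE (at_ vcol vv) (ECst c))))))
  (PSeq extend consider).
Definition explore := PSeq decode (PSeq colour (PSeq (try_colour 1) (try_colour 2))).
(** The starting value n + 1 exceeds the size of every vertex set, so the first [consider] always
    stores its candidate. *)
Definition initialize := PSeq (PPut vbestcnt (ECst 0) (EAdd (varE 0) (ECst 1)))
  (PSeq extend (PSeq consider (PFor vi 0 (PPut vF (varE vi) (at_ vcur vi))))).
Definition search := PFor vg vN explore.
Definition output_best := PFor vi 0 (PPut 2 (varE vi) (zeroE (at_ vbest vi))).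

Section Search.
Variables (n : nat) (G : sgraph 'I_n).
Implicit Types (m : memory) (C W B F D : {set 'I_n}).
Local Notation env := (env G).
Local Notation maximal_acyc := (maximal_acyc G).

Definition best m B := [/\ stores m vbest B, m vbestcnt 0 = #|B| & maximal_acyc B].

Lemma best_eq m m' B : m' vbest = m vbest -> m' vbestcnt = m vbestcnt -> best m B -> best m' B.
Proof. by rewrite /best /stores => -> ->. Qed.

Lemma count_currentE m C : env m -> stores m vcur C -> den count_current m vcnt 0 = #|C|.
Proof.
move=> en mC; rewrite /count_current den_seq den_put /=; set m1 := upd _ _ _ _.
have fr a : a != vcnt -> m1 a = m a by move=> h; rewrite /m1 updNa.
have en1 : env m1 by apply: env_eq en; rewrite fr.
have -> : #|C| = #|[set i : 'I_n in C | i < n]|.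
  by congr #|pred_of_set _|; apply/setP => i; rewrite inE ltn_ord andbT.
apply: (@den_for_ord n vi _ m1 (fun k m' => m' vcnt 0 = #|[set i : 'I_n in C | i < k]|)) => //.
- by case: en1.
- rewrite updNa // /m1 updE; apply/esym/eqP; rewrite cards_eq0.
  by apply/eqP/setP => i; rewrite !inE ltn0 andbF.
move=> k m' km' fr' IH; rewrite updNa // den_put updE /= IH km' fr' // fr // mC.
have kS : k \notin [set i : 'I_n in C | i < k] by rewrite inE ltnn andbF.
case: (boolP (k \in C)) => kC /=.
  transitivity #|k |: [set i : 'I_n in C | i < k]|; first by rewrite cardsU1 kS addnC.
  congr #|pred_of_set _|; apply/setP => i; rewrite !inE ltnS [i <= k]leq_eqVlt (inj_eq val_inj).
  by case: eqVneq => // ->; rewrite kC.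
rewrite addn0; congr #|pred_of_set _|; apply/setP => i.
rewrite !inE ltnS [i <= k]leq_eqVlt (inj_eq val_inj).
by case: eqVneq => // ->; rewrite (negbTE kC).
Qed.

Lemma considerE m C : env m -> stores m vcur C -> maximal_acyc C ->
  (exists B, best m B) \/ m vbestcnt 0 = n.+1 ->
  exists B, [/\ best (den consider m) B, #|B| <= #|C| & #|B| <= m vbestcnt 0].
Proof.
move=> en mC xC hb; rewrite /consider den_seq; set m1 := den _ m.
have fr a : a \notin writes count_current -> m1 a = m a by apply: den_frame.
have c1 : m1 vcnt 0 = #|C| by apply: count_currentE.
have en1 : env m1 by apply: env_eq en; rewrite fr.
rewrite /PWhen den_if /= fr // c1 subn_eq0 -ltnNge.
have [lt|ge] := ltnP #|C| (m vbestcnt 0).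
  exists C; split=> //; last exact: ltnW.
  rewrite /keep_current den_seq den_put /= c1; set m2 := upd _ _ _ _.
  split=> //; last by rewrite den_frame // /m2 updE.
  have mn2 : m2 0 0 = n by case: en1.
  move=> i; rewrite (@den_map n vi vbest _ m2 (fun k => m vcur k)) // => k m' km' fr'.
  by rewrite eval_at km' fr' // /m2 updNa // fr.
case: hb => [[B [b1 b2 b3]]|hb].
  by exists B; rewrite -b2; split=> //; rewrite -[den _ _]/m1; split=> //; [move=> i|]; rewrite fr.
by have := max_card C; rewrite card_ord; move: ge; rewrite hb; lia.
Qed.

(* The digit n stands for no vertex, so sets of size less than K have codes too. *)
Definition digits K g : {set 'I_n} :=
  [set i : 'I_n | has (fun j => (g %/ n.+1 ^ j) %% n.+1 == i) (iota 0 K)].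

Lemma digits_surj K D : #|D| <= K -> exists2 g, g < n.+1 ^ K & digits K g = D.
Proof.
move=> DK.
have code s : all (fun x => x <= n) s -> exists2 g, g < n.+1 ^ size s &
    forall j, j < size s -> (g %/ n.+1 ^ j) %% n.+1 = nth 0 s j.
  elim: s => [|x s IHs] /=; first by exists 0.
  move=> /andP[xn /IHs[g gs gE]]; exists (x + g * n.+1).
    rewrite expnS mulnC; apply: (@leq_trans (n.+1 + g * n.+1)); first by lia.
    by have := leq_mul gs (leqnn n.+1); lia.
  case=> [|j] js; first by rewrite expn0 divn1 addnC modnMDl modn_small.
  have e : (x + g * n.+1) %/ n.+1 = g by rewrite addnC divnMDl // divn_small // addn0.
  by rewrite expnS divnMA e gE.
pose s := [seq val i | i <- enum D] ++ nseq (K - #|D|) n.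
have sK : size s = K by rewrite size_cat size_map size_nseq -cardE subnKC.
have [|g gK gE] := code s.
  rewrite all_cat; apply/andP; split; last by apply/allP => x /nseqP[->].
  by apply/allP => _ /mapP[i _ ->]; exact: ltnW (ltn_ord i).
rewrite sK in gK gE; exists g => //; apply/setP => i; rewrite inE.
have -> : has (fun j => (g %/ n.+1 ^ j) %% n.+1 == i) (iota 0 K) = (val i \in s).
  apply/hasP/idP => [[j]|/(nthP 0)[j]].
    by rewrite mem_iota add0n => jK /eqP e; rewrite -[val i]/(nat_of_ord i) -e gE // mem_nth ?sK.
  by rewrite sK => jK e; exists j; rewrite ?mem_iota ?gE ?e.
rewrite mem_cat mem_map; last exact: val_inj.
by rewrite mem_enum mem_nseq (ltn_eqF (ltn_ord i)) andbF orbF.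
Qed.

Lemma divideE m N : m 0 0 = n -> m vN 0 = N -> m vrem 0 < N ->
  den divide m vrem 0 = m vrem 0 %% n.+1 /\ den divide m vquo 0 = m vrem 0 %/ n.+1.
Proof.
move=> mn mN gN; set g := m vrem 0 in gN *.
rewrite /divide den_seq den_put /=; set m1 := upd _ _ _ _.
suff [h1 h2] : den (PFor vi vN (PWhen (ESub (varE vrem) (varE 0)) divide_step)) m1 vrem 0
      + den (PFor vi vN (PWhen (ESub (varE vrem) (varE 0)) divide_step)) m1 vquo 0 * n.+1 = g /\
    (den (PFor vi vN (PWhen (ESub (varE vrem) (varE 0)) divide_step)) m1 vrem 0 <= n \/
     m1 vN 0 <= den (PFor vi vN (PWhen (ESub (varE vrem) (varE 0)) divide_step)) m1 vquo 0).
  move: h1 h2; set r := den _ _ vrem 0; set q := den _ _ vquo 0.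
  have -> : m1 vN 0 = N by rewrite /m1 updNa.
  (* A quotient of at least [N] would give [g >= N]. *)
  move=> e [rn|Nq]; last by nia.
  by rewrite -e addnC modnMDl divnMDl // modn_small // divn_small // addn0.
apply: (@den_for_ind vi vN _ m1 (fun k m' =>
  m' vrem 0 + m' vquo 0 * n.+1 = g /\ (m' vrem 0 <= n \/ k <= m' vquo 0))) => //.
  by rewrite !updNa // /m1 updE addn0; split=> //; right.
move=> k m' _ km' fr [e h]; rewrite !updNa // /PWhen den_if /=.
have m'n : m' 0 0 = n by rewrite fr // /m1 updNa.
rewrite m'n subn_eq0 -ltnNge; have [lt|le] := ltnP n (m' vrem 0); last by split=> //; left.
rewrite /divide_step den_seq !den_put /= !updE [upd _ vquo _ _ vrem]updNa // [upd _ vrem _ _ vquo]updNa // updE m'n.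
split; first by lia.
by right; case: h; lia.
Qed.

Lemma decodeE m K g : m 0 0 = n -> m vK 0 = K -> m vg 0 = g -> g < m vN 0 ->
  stores (den decode m) vD (digits K g).
Proof.
move=> mn mK mg gN; rewrite /decode den_seq; set m1 := den _ m.
have fr1 a : a != vi -> a != vD -> m1 a = m a.
  by move=> h1 h2; apply: den_frame; rewrite !inE negb_or h1.
have D1 (i : 'I_n) : m1 vD i = 0 by apply: (@den_map n vi vD _ m (fun=> 0)).
rewrite den_seq den_put /= fr1 // mg; set m2 := upd _ _ _ _.
have fr2 a : a != vrem -> m2 a = m1 a by move=> h; rewrite /m2 updNa.
have m2K : m2 vK 0 = K by rewrite fr2 // fr1.
set p := PFor _ _ _.
suff [] : stores (den p m2) vD (digits (m2 vK 0) g) /\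
    den p m2 vrem 0 = g %/ n.+1 ^ (m2 vK 0) by rewrite m2K.
apply: (@den_for_ind vj vK _ m2 (fun k m' => stores m' vD (digits k g) /\
    m' vrem 0 = g %/ n.+1 ^ k)) => //.
  rewrite !updNa // /m2 updE expn0 divn1; split=> // i.
  by rewrite !updNa // D1 inE.
move=> k m' _ km' fr [mD mr]; rewrite den_seq; set m3 := den divide m'.
have m'n : m' 0 0 = n by rewrite fr // fr2 // fr1.
have m'N : m' vN 0 = m vN 0 by rewrite fr // fr2 // fr1.
have [|r3 q3] := divideE m'n m'N.
  by rewrite mr; apply: leq_ltn_trans gN; apply: leq_div.
rewrite -/m3 mr in r3 q3.
have fr3 a : a \notin writes divide -> m3 a = m' a by apply: den_frame.
rewrite den_seq !den_put /= r3; split; last first.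
  rewrite [upd _ vj _ _ vrem]updNa // updE [upd _ vD _ _ vquo]updNa // q3.
  by rewrite expnSr divnMA.
move=> i; rewrite [upd _ vj _ _ vD]updNa // [upd _ vrem _ _ vD]updNa // inE.
have -> : iota 0 k.+1 = iota 0 k ++ [:: k] by rewrite -[k.+1]addn1 iotaD.
rewrite has_cat /= orbF.
have [e|ne] := eqVneq; first by rewrite e updE orbT.
by rewrite updNk 1?eq_sym // fr3 // mD inE orbF.
Qed.

Lemma try_colourE m c D : env m -> stores m vD D -> (exists B, best m B) ->
  exists C, [/\ maximal_acyc C,
    acyc G (colour_class D (col_of m) c) -> colour_class D (col_of m) c \subset C &
    exists B, [/\ best (den (try_colour c) m) B, #|B| <= #|C| & #|B| <= m vbestcnt 0]].
Proof.
move=> en mD hb; set W := colour_class _ _ _.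
rewrite /try_colour den_seq; set m1 := den _ m.
have fr1 a : a != vv -> a != vW -> m1 a = m a.
  by move=> h1 h2; apply: den_frame; rewrite !inE negb_or h1.
have en1 : env m1 by apply: env_eq en; rewrite fr1.
have mn : m 0 0 = n by case: en.
have W1 : stores m1 vW W.
  move=> i; rewrite /m1 (@den_map n vv vW _ m (fun k => (m vD k != 0) || (m vcol k == c))) //.
    by rewrite mD eqb0 negbK !inE.
  move=> k m' km' fr; rewrite eval_nonzeroE /= km' !fr //; lia.
have [C [mC xC sC]] := extendE en1 W1; exists C; split=> //.
rewrite den_seq; set m2 := den extend m1.
have fr2 a : a \notin writes extend -> m2 a = m1 a by apply: den_frame.
have en2 : env m2 by apply: env_eq en1; rewrite fr2.
have [|B [b1 b2 b3]] := considerE en2 mC xC.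
  left; have [B [h1 h2 h3]] := hb; exists B; split=> //; first move=> i.
    by rewrite fr2 // fr1.
  by rewrite fr2 // fr1.
by exists B; split=> //; rewrite fr2 // fr1 in b3.
Qed.

Lemma explored_mono F V V' D : V <= V' -> explored G F V D -> explored G F V' D.
Proof.
move=> VV' [[W [h1 h2 h3]] h4]; split; last by lia.
by exists W; split=> //; apply: leq_trans VV'.
Qed.

Lemma card_setC_anti B B' : #|B'| <= #|B| -> #|~: B| <= #|~: B'|.
Proof. by have := cardsC B; have := cardsC B'; rewrite card_ord; lia. Qed.

Lemma exploreE m F K g : env m -> acyc G F -> stores m vF F ->
  m vK 0 = K -> m vg 0 = g -> g < m vN 0 -> forall B, best m B ->
  exists B', [/\ best (den explore m) B', #|B'| <= #|B| &
    acyc G (digits K g) -> explored G F #|~: B'| (digits K g)].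
Proof.
move=> en aF mF mK mg gN B bB; set D := digits K g.
have mn : m 0 0 = n by case: en.
rewrite /explore den_seq; set m1 := den decode m.
have fr1 a : a \notin writes decode -> m1 a = m a by apply: den_frame.
have en1 : env m1 by apply: env_eq en; rewrite fr1.
have D1 : stores m1 vD D by apply: decodeE.
have F1 : stores m1 vF F by move=> i; rewrite fr1 // mF.
rewrite den_seq; set m2 := den colour m1.
have fr2 a : a \notin writes colour -> m2 a = m1 a by apply: den_frame.
have en2 : env m2 by apply: env_eq en1; rewrite fr2.
have D2 : stores m2 vD D by move=> i; rewrite fr2 // D1.
have b2 : best m2 B.
  by have [h1 h2 h3] := bB; split=> //; first move=> i; rewrite fr2 // fr1.
have [C1 [x1 s1 [B1 [b3 l1 l1']]]] :=
  @try_colourE m2 1 D en2 D2 (ex_intro _ B b2).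
rewrite den_seq; set m3 := den _ m2 in b3 *.
have fr3 a : a \notin writes (try_colour 1) -> m3 a = m2 a by apply: den_frame.
have en3 : env m3 by apply: env_eq en2; rewrite fr3.
have D3 : stores m3 vD D by move=> i; rewrite fr3 // D2.
(* The first attempt changes neither [D] nor the colours, so the second extends the other class of
   the same colouring. *)
have c3 : @col_of n m3 = @col_of n m2 by apply: funext => i; rewrite /col_of fr3.
have [C2 [x2 s2 [B2 [b4 l2 l2']]]] := @try_colourE m3 2 D en3 D3 (ex_intro _ B1 b3).
rewrite c3 in s2.
have e1 : m2 vbestcnt 0 = #|B| by case: b2.
have e3 : m3 vbestcnt 0 = #|B1| by case: b3.
exists B2; split=> //; [by lia|move=> aD].
have h1 : #|~: C1| <= #|~: B2| by apply: card_setC_anti; lia.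
have h2 : #|~: C2| <= #|~: B2| by apply: card_setC_anti.
have [R cR sL] := colourE en1 aF aD F1 D1.
have {}s1 := s1 (col_acyc cR (isT : 0 < 1)).
have {}s2 := s2 (col_acyc cR (isT : 0 < 2)).
have h := colouring_escape cR sL x1.1 x2.1 s1 s2.
split; last by lia.
exists C1; split=> //; first exact: x1.1.
by apply: subset_trans s1; apply: subsetUl.
Qed.

End Search.

(** * Size of the enumerated sets *)

Local Notation vacc := 29 (only parsing).
Local Notation vrr := 30 (only parsing).
Local Notation vq := 31 (only parsing).
Local Notation vsq := 32 (only parsing).
Local Notation vinc := 33 (only parsing).
Local Notation vstep := 34 (only parsing).
Local Notation vh := 35 (only parsing).
Local Notation vtot := 36 (only parsing).
Local Notation vtmp := 37 (only parsing).

Definition PAdd a x := PPut a (ECst 0) (EAdd (varE a) x).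

Definition row_table := PFor vi 0
  (PPut vrow (EAdd (varE vi) (ECst 1)) (EAdd (at_ vrow vi) (varE 0))).
(** Finds the minimum of n and the integer part of r by repeated addition of the denominator. *)
Definition ratio_floor := PFor vi 0
  (PWhen (ESub (EAdd (EGet 0 (ECst 1)) (ECst 1)) (EAdd (varE vacc) (EGet 0 (ECst 2))))
    (PSeq (PAdd vacc (EGet 0 (ECst 2))) (PAdd vrr (ECst 1)))).
(** The integer part of sqrt(rr/7): [vsq] runs through 7 q^2 and [vinc] is the gap 7 (2q + 1) to the
    next value. *)
Definition ratio_sqrt := PSeq (PPut vinc (ECst 0) (ECst 7)) (PFor vi 0
  (PWhen (ESub (EAdd (varE vrr) (ECst 1)) (EAdd (varE vsq) (varE vinc)))
    (PSeq (PAdd vsq (varE vinc)) (PSeq (PAdd vinc (ECst 14)) (PAdd vq (ECst 1)))))).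
Definition step_size := PFor vi vq (PAdd vstep (varE vrr)).
(** [vh] becomes n / (q * rr) rounded up, capped at n, and [vK] is four times that, the largest
    closure of two parts. *)
Definition part_size := PSeq
  (PFor vi 0 (PWhen (ESub (varE 0) (varE vtot))
    (PSeq (PAdd vtot (varE vstep)) (PAdd vh (ECst 1)))))
  (PPut vK (ECst 0) (EAdd (EAdd (varE vh) (varE vh)) (EAdd (varE vh) (varE vh)))).
(** Each outer iteration multiplies [vN] by n + 1, adding its old value n times. *)
Definition code_bound := PSeq (PPut vN (ECst 0) (ECst 1))
  (PFor vj vK (PSeq (PPut vtmp (ECst 0) (varE vN)) (PFor vi 0 (PAdd vN (varE vtmp))))).

Definition phase1 := PSeq row_table (PSeq ratio_floor ratio_sqrt).
Definition phase5 := PSeq initialize (PSeq search output_best).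

(** Compiled in five pieces: the loop bounds [vq], [vK] and [vN] are results of earlier pieces,
    whereas [exec_compile] wants them fixed at the start. *)
Definition algorithm := CSeq (compile phase1) (CSeq (compile step_size)
  (CSeq (compile part_size) (CSeq (compile code_bound) (compile phase5)))).

(* The constant 7 comes from [approximation]: V + 6 q^2 V <= 7 q^2 V <= r V.  When
   q = 0, the loop computing h makes h = n, so that all sets are enumerated. *)
Definition parameters (n num dnm rr q h : nat) : Prop :=
  [/\ rr * dnm <= num /\ (rr = n \/ num < rr.+1 * dnm),
      rr <= n, q <= n /\ 7 * (q * q) <= rr, rr < 7 * (q.+1 * q.+1) &
      [/\ h <= n, h = n \/ n <= h * (q * rr) & h = 0 \/ h.-1 * (q * rr) < n]].

Section SearchParameters.
Variables (n : nat) (G : sgraph 'I_n).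
Local Notation env := (env G).

Lemma row_tableE m : m 0 0 = n -> m vrow 0 = 0 ->
  forall i, i <= n -> den row_table m vrow i = i * n.
Proof.
move=> mn m0.
apply: (@den_for_ord n vi _ m (fun k m' => forall i, i <= k -> m' vrow i = i * n)) => //.
  by move=> i; rewrite leqn0 => /eqP ->; rewrite updNa.
move=> k m' km' fr IH i ik; rewrite updNa // den_put /= km' (fr 0) // mn addn1.
have [->|ne] := eqVneq i k.+1; first by rewrite updE IH // mulSn addnC.
by rewrite updNk // IH //; move: ik; rewrite leq_eqVlt (negbTE ne).
Qed.

Lemma ratio_floorE m num dnm : m 0 0 = n -> m 0 1 = num -> m 0 2 = dnm ->
  m vacc 0 = 0 -> m vrr 0 = 0 ->
  let rr := den ratio_floor m vrr 0 in
  [/\ rr * dnm <= num, rr <= n & rr = n \/ num < rr.+1 * dnm].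
Proof.
move=> mn m1 m2 ma mr.
suff [_ //] : den ratio_floor m vacc 0 = den ratio_floor m vrr 0 * dnm /\
  [/\ den ratio_floor m vrr 0 * dnm <= num, den ratio_floor m vrr 0 <= n &
     den ratio_floor m vrr 0 = n \/ num < (den ratio_floor m vrr 0).+1 * dnm].
apply: (@den_for_ord n vi _ m (fun k m' => m' vacc 0 = m' vrr 0 * dnm /\
  [/\ m' vrr 0 * dnm <= num, m' vrr 0 <= k & m' vrr 0 = k \/ num < (m' vrr 0).+1 * dnm])) => //.
  by rewrite !updNa // ma mr mul0n; split=> //; split=> //; left.
move=> k m' km' fr [ea [h1 h2 h3]].
rewrite [upd _ vi _ _ vacc]updNa // [upd _ vi _ _ vrr]updNa // den_when /= (fr 0) // m1 m2.
rewrite ea subn_eq0 -ltnNge; case: ltnP => c; last first.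
  split=> //; split=> //; first exact: leqW.
  by right; rewrite mulSn; lia.
rewrite den_seq !den_put /= !updE [upd _ vacc _ _ vrr]updNa // [upd _ vrr _ _ vacc]updNa // updE.
rewrite (fr 0) // m2 ea; split; first by lia.
by split; [lia|lia|case: h3 => [->|]; [left; lia|rewrite mulSn; lia]].
Qed.

Lemma ratio_sqrtE m rr : m 0 0 = n -> m vrr 0 = rr -> m vsq 0 = 0 -> m vq 0 = 0 -> rr <= n ->
  let q := den ratio_sqrt m vq 0 in
  [/\ q <= n, 7 * (q * q) <= rr & rr < 7 * (q.+1 * q.+1)].
Proof.
move=> mn mr ms mq rn; rewrite /ratio_sqrt den_seq den_put /=.
set m1 := upd _ _ _ _; set p := PFor _ _ _.
have mn1 : m1 0 0 = n by rewrite /m1 updNa.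
suff [_ _ [h1 h2 h3]] : [/\ den p m1 vsq 0 = 7 * (den p m1 vq 0 * den p m1 vq 0),
   den p m1 vinc 0 = 14 * den p m1 vq 0 + 7 &
   [/\ den p m1 vq 0 <= n, 7 * (den p m1 vq 0 * den p m1 vq 0) <= rr &
    den p m1 vq 0 = n \/ rr < 7 * ((den p m1 vq 0).+1 * (den p m1 vq 0).+1)]].
  by split=> //; case: h3 => // e; move: h2; rewrite e; nia.
apply: (@den_for_ord n vi _ m1 (fun k m' =>
  [/\ m' vsq 0 = 7 * (m' vq 0 * m' vq 0), m' vinc 0 = 14 * m' vq 0 + 7 &
   [/\ m' vq 0 <= k, 7 * (m' vq 0 * m' vq 0) <= rr &
    m' vq 0 = k \/ rr < 7 * ((m' vq 0).+1 * (m' vq 0).+1)]])) => //.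
  rewrite !updNa // /m1 updE [upd _ vinc _ _ vq]updNa // [upd _ vinc _ _ vsq]updNa // mq ms.
  by split=> //; split=> //; left.
move=> k m' km' fr [es ei [h1 h2 h3]].
rewrite [upd _ vi _ _ vsq]updNa // [upd _ vi _ _ vq]updNa // [upd _ vi _ _ vinc]updNa //.
have mr' : m' vrr 0 = rr by rewrite fr // /m1 updNa.
rewrite den_when /= mr' es ei subn_eq0 -ltnNge.
move: es ei h1 h2 h3; set q := m' vq 0 => es ei h1 h2 h3.
case: ltnP => c; last first.
  split=> //; split=> //; first exact: leqW.
  by right; nia.
rewrite !den_seq !den_put /=.
set m2 := upd m' _ _ _; set m3 := upd m2 _ _ _.
have e3q : m3 vq 0 = q by rewrite /m3 updNa // /m2 updNa.
have e3i : m3 vinc 0 = 14 * q.+1 + 7 by rewrite /m3 updE /m2 updNa // ei; lia.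
have e3s : m3 vsq 0 = 7 * (q.+1 * q.+1) by rewrite /m3 updNa // /m2 updE es ei; nia.
rewrite updE [upd _ vq _ _ vsq]updNa // [upd _ vq _ _ vinc]updNa // e3q e3i e3s addn1.
by split=> //; split; [lia|nia|case: h3 => [->|]; [left|nia]].
Qed.

Lemma step_sizeE m rr q : m vq 0 = q -> m vrr 0 = rr -> m vstep 0 = 0 ->
  den step_size m vstep 0 = q * rr.
Proof.
move=> mq mr ms; rewrite -mq.
apply: (@den_for_ind vi vq _ m (fun k m' => m' vstep 0 = k * rr)) => //.
move=> k m' _ km' fr IH; rewrite updNa // den_put /= updE IH fr // mr mulSn; lia.
Qed.

Lemma part_sizeE m s : m 0 0 = n -> m vstep 0 = s -> m vtot 0 = 0 -> m vh 0 = 0 ->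
  exists h, [/\ den part_size m vK 0 = 4 * h, h <= n, h = n \/ n <= h * s &
    h = 0 \/ h.-1 * s < n].
Proof.
move=> mn ms mt mh; rewrite /part_size den_seq den_put /=; set m1 := den _ m.
exists (m1 vh 0); rewrite updE; split; first by lia.
all: suff [_ [h1 h2 h3]] : m1 vtot 0 = m1 vh 0 * s /\
  [/\ m1 vh 0 <= n, m1 vh 0 = n \/ n <= m1 vh 0 * s & m1 vh 0 = 0 \/ (m1 vh 0).-1 * s < n] by [].
all: apply: (@den_for_ord n vi _ m (fun k m' => m' vtot 0 = m' vh 0 * s /\
  [/\ m' vh 0 <= k, m' vh 0 = k \/ n <= m' vh 0 * s & m' vh 0 = 0 \/ (m' vh 0).-1 * s < n])) => //;
  first by (rewrite !updNa // mt mh mul0n; split=> //; split=> //; left).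
all: move=> k m' km' fr [et [h1 h2 h3]].
all: rewrite [upd _ vi _ _ vtot]updNa // [upd _ vi _ _ vh]updNa // den_when /= (fr 0) // mn et.
all: rewrite subn_eq0 -ltnNge; case: ltnP => c; last by split=> //; split=> //; [exact: leqW|right].
all: rewrite den_seq !den_put /= !updE [upd _ vh _ _ vtot]updNa // [upd _ vtot _ _ vh]updNa // updE.
all: rewrite et (fr vstep) // ms addn1 /=; split; first by rewrite mulSn addnC.
all: by split; [lia|case: h2 => [->|]; [left|lia]|right].
Qed.

Lemma code_boundE m K : m 0 0 = n -> m vK 0 = K -> den code_bound m vN 0 = n.+1 ^ K.
Proof.
move=> mn mK; rewrite /code_bound den_seq den_put /=; set m1 := upd _ _ _ _.
have <- : m1 vK 0 = K by rewrite /m1 updNa.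
apply: (@den_for_ind vj vK _ m1 (fun k m' => m' vN 0 = n.+1 ^ k)) => //.
move=> k m' _ km' fr IH; rewrite updNa // den_seq den_put /=.
set m2 := upd _ _ _ _; rewrite expnS mulSn addnC.
have m2n : m2 0 0 = n by rewrite /m2 updNa // fr // /m1 updNa.
apply: (@den_for_ord n vi _ m2 (fun k' m' => m' vN 0 = k' * n.+1 ^ k + n.+1 ^ k)) => //.
move=> k' m3 _ fr3 IH3; rewrite updNa // den_put /= updE IH3 fr3 // /m2 updE IH.
by rewrite mulSn; lia.
Qed.

Lemma searchE m F K N B0 : env m -> acyc G F -> stores m vF F ->
  m vK 0 = K -> m vN 0 = N -> best G m B0 ->
  exists B, [/\ best G (den search m) B, #|B| <= #|B0| &
    forall g, g < N -> acyc G (digits n K g) -> explored G F #|~: B| (digits n K g)].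
Proof.
move=> en aF mF mK mN b0; rewrite -mN.
apply: (@den_for_ind vg vN _ m (fun k m' => exists B, [/\ best G m' B, #|B| <= #|B0| &
    forall g, g < k -> acyc G (digits n K g) -> explored G F #|~: B| (digits n K g)])) => //.
  by exists B0.
move=> k m' kN km' fr [B [b1 l1 h1]].
have en' : env m' by apply: env_eq en; rewrite fr.
have F' : stores m' vF F by move=> i; rewrite fr.
have [||B' [b2 l2 h2]] := @exploreE n G m' F K k en' aF F' _ km' _ B b1; try by rewrite fr.
exists B'; split; [by apply: best_eq b2; rewrite updNa | exact: leq_trans l1 |].
move=> g; rewrite ltnS leq_eqVlt => /predU1P[-> //|gk] aD.
by apply: explored_mono (h1 g gk aD); apply: card_setC_anti.
Qed.

Lemma initializeE m : env m -> (forall i, m vW i = 0) ->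
  exists F B, [/\ maximal_acyc G F, best G (den initialize m) B, #|B| <= #|F| &
    stores (den initialize m) vF F].
Proof.
move=> en W0; rewrite /initialize den_seq den_put /=.
set m1 := upd _ _ _ _.
have fr1 a : a != vbestcnt -> m1 a = m a by move=> h; rewrite /m1 updNa.
have en1 : env m1 by apply: env_eq en; rewrite fr1.
have [|F [F2 xF _]] := @extendE n G m1 set0 en1.
  by move=> i; rewrite inE fr1 // W0.
rewrite den_seq; set m2 := den extend m1 in F2 *.
have fr2 a : a \notin writes extend -> m2 a = m1 a by apply: den_frame.
have en2 : env m2 by apply: env_eq en1; rewrite fr2.
have [|B [b3 l3 _]] := considerE en2 F2 xF.
  by right; rewrite fr2 // /m1 updE en.1 addn1.
rewrite den_seq; set m3 := den consider m2 in b3 *.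
have fr3 a : a \notin writes consider -> m3 a = m2 a by apply: den_frame.
set m4 := den _ m3.
have fr4 a : a != vi -> a != vF -> m4 a = m3 a.
  by move=> h1 h2; apply: den_frame; rewrite !inE negb_or h1.
exists F, B; split=> //; first by apply: best_eq b3; apply: fr4.
have mn3 : m3 0 0 = n by rewrite fr3 //; case: en2.
move=> i; rewrite /m4 (@den_map n vi vF _ m3 (fun k => m3 vcur k)) //; first by rewrite fr3.
by move=> k m' km' fr; rewrite eval_at km' fr.
Qed.

Lemma phase5E m K : env m -> (forall i, m vW i = 0) -> m vK 0 = K -> m vN 0 = n.+1 ^ K ->
  exists F B, [/\ maximal_acyc G F, maximal_acyc G B, #|~: F| <= #|~: B|,
    forall D, acyc G D -> #|D| <= K -> explored G F #|~: B| D &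
    output n (den phase5 m) = ~: B].
Proof.
move=> en W0 mK mN; rewrite /phase5 den_seq.
have [F [B0 [xF b4 l3 F4]]] := initializeE en W0; set m4 := den _ m in b4 F4 *.
have fr4 a : a \notin writes initialize -> m4 a = m a by apply: den_frame.
have en4 : env m4 by apply: env_eq en; rewrite fr4.
have K4 : m4 vK 0 = K by rewrite fr4.
have N4 : m4 vN 0 = n.+1 ^ K by rewrite fr4.
have [B [[b5 _ xB] l5 h5]] := searchE en4 xF.1 F4 K4 N4 b4.
rewrite den_seq; set m5 := den search m4 in b5 *.
have fr5 a : a \notin writes search -> m5 a = m4 a by apply: den_frame.
have mn5 : m5 0 0 = n by rewrite fr5 //; case: en4.
exists F, B; split=> //.
- by apply: card_setC_anti; apply: leq_trans l3.
- by move=> D aD /digits_surj[g gN eD]; rewrite -eD in aD *; apply: h5.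
- apply/setP => i; rewrite /output_best !inE (@den_map n vi 2 _ m5 (fun k => m5 vbest k == 0)) //.
    by rewrite b5; case: (i \in B).
  by move=> k m' km' fr; rewrite eval_zeroE eval_at km' fr.
Qed.

End SearchParameters.

(** * Assembling the phases *)

Section Correctness.
Variables (n : nat) (G : sgraph 'I_n) (r : rat).
Let num := absz (numq r).
Let dnm := absz (denq r).

Lemma input_adj (i j : 'I_n) : input G r 1 (i * n + j) = G i j.
Proof.
rewrite /input; congr nat_of_bool; apply/existsP/idP => [[i' /existsP[j' /andP[/eqP e g]]]|g].
  have n0 : 0 < n by apply: leq_trans (ltn_ord i).
  have ei : i = i'.
    apply/ord_inj; have := congr1 (divn^~ n) e.
    by rewrite /= !divnMDl // !divn_small // !addn0.
  have ej : j = j' by apply/ord_inj/eqP; rewrite -(eqn_add2l (i * n)) e ei.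
  by rewrite ei ej.
by exists i; apply/existsP; exists j; rewrite eqxx.
Qed.

(** With [K] = 4h, one number bounds all loops, whose lengths are n, q <= n, 4h <= 4n or
    (n+1)^(4h). *)
Lemma leq_bound K : n <= (n + 2) ^ (K + 3) /\ 4 * n <= (n + 2) ^ (K + 3) /\
  n.+1 ^ K <= (n + 2) ^ (K + 3).
Proof.
have h3 : 4 * n <= (n + 2) ^ 3 by rewrite !expnS expn0; nia.
have hK : n.+1 ^ K <= (n + 2) ^ K by case: K => // K; rewrite leq_exp2r // addn2.
have p3 : 0 < (n + 2) ^ 3 by rewrite expn_gt0 addn2.
have pK : 0 < (n + 2) ^ K by rewrite expn_gt0 addn2.
rewrite expnD; set a := _ ^ K in hK pK *; set b := (n + 2) ^ 3 in h3 p3 *.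
by split; [nia | split; nia].
Qed.

Lemma algorithmE : exists rr q h, parameters n num dnm rr q h /\
  exists t m F B, [/\ exec algorithm (input G r) t m,
    t <= time (PSeq phase1 (PSeq step_size (PSeq part_size (PSeq code_bound phase5))))
           ((n + 2) ^ (4 * h + 3)) &
    [/\ maximal_acyc G F, maximal_acyc G B, #|~: F| <= #|~: B|,
      forall D, acyc G D -> #|D| <= 4 * h -> explored G F #|~: B| D & output n m = ~: B]].
Proof.
set m0 := input G r; set m1 := den phase1 m0.
have fr1 a : a \notin writes phase1 -> m1 a = m0 a by apply: den_frame.
have [rr [q [hrr rrn qrr rrq [row1 e1 e1']]]] : exists rr q,
    [/\ rr * dnm <= num /\ (rr = n \/ num < rr.+1 * dnm),
      rr <= n, q <= n /\ 7 * (q * q) <= rr, rr < 7 * (q.+1 * q.+1) &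
      [/\ forall i, i <= n -> m1 vrow i = i * n, m1 vrr 0 = rr & m1 vq 0 = q]].
  rewrite /m1 /phase1 2!den_seq; set ma := den row_table m0; set mb := den ratio_floor ma.
  have fra a : a \notin writes row_table -> ma a = m0 a by apply: den_frame.
  have frb a : a \notin writes ratio_floor -> mb a = ma a by apply: den_frame.
  have [] := @ratio_floorE n ma num dnm; rewrite ?fra // -/mb => h1 h2 h3.
  have sq0 : mb vsq 0 = 0 by rewrite frb // fra.
  have q0 : mb vq 0 = 0 by rewrite frb // fra.
  have mbn : mb 0 0 = n by rewrite frb // fra.
  have [h4 h5 h6] := ratio_sqrtE mbn (erefl _) sq0 q0 h2.
  exists (mb vrr 0), (den ratio_sqrt mb vq 0); split=> //; split=> //; last by rewrite den_frame.
  move=> i ni; rewrite den_frame // frb //; exact: row_tableE.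
set m2 := den step_size m1; have fr2 a : a \notin writes step_size -> m2 a = m1 a by apply: den_frame.
have s2 : m2 vstep 0 = q * rr by apply: step_sizeE => //; rewrite fr1.
have n2 : m2 0 0 = n by rewrite fr2 // fr1.
have t2 : m2 vtot 0 = 0 by rewrite fr2 // fr1.
have h02 : m2 vh 0 = 0 by rewrite fr2 // fr1.
have [h [K3 h1 h2 h3]] := part_sizeE n2 s2 t2 h02; set m3 := den part_size m2 in K3 *.
have fr3 a : a \notin writes part_size -> m3 a = m2 a by apply: den_frame.
have n3 : m3 0 0 = n by rewrite fr3.
have N4 := code_boundE n3 K3; set m4 := den code_bound m3 in N4.
have fr4 a : a \notin writes code_bound -> m4 a = m3 a by apply: den_frame.
have z a : a \notin writes code_bound -> a \notin writes part_size ->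
   a \notin writes step_size -> m4 a = m1 a.
  by move=> ? ? ?; rewrite fr4 // fr3 // fr2.
have en4 : env G m4.
  split; first by rewrite z // fr1.
  by move=> i j; rewrite !z // row1 1?ltnW // fr1 // /m0 input_adj.
have [||F [B [xF xB FB ex out]]] := phase5E en4 _ _ N4.
- by move=> i; rewrite z // fr1.
- by rewrite fr4.
exists rr, q, h; split; first by split.
have [b1 [b2 b3]] := leq_bound (4 * h).
have hB : 4 * h <= (n + 2) ^ (4 * h + 3) by apply: leq_trans b2; rewrite leq_mul2l h1 orbT.
have qB : q <= (n + 2) ^ (4 * h + 3) by apply: leq_trans b1; case: qrr.
set Bd := _ ^ _ in b1 b2 b3 hB qB *.
have e0 p m : well_formed p -> all (pred1 0) (bounds p) -> 0 \notin writes p -> m 0 = m0 0 ->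
    exists2 t, exec (compile p) m t (den p m) & t <= time p Bd.
  move=> wp /allP bp np em; apply: exec_compile => // b /bp /eqP ->.
  by split=> //; rewrite em.
have [t1 x1 l1] := e0 phase1 m0 isT isT isT (erefl _).
have [|u2 x2 l2] := @exec_compile step_size m1 Bd isT.
  by move=> b; rewrite inE => /eqP ->; rewrite e1'.
have [|t3 x3 l3] := e0 part_size m2 isT isT isT; first by rewrite fr2 // fr1.
have [|t4 x4 l4] := @exec_compile code_bound m3 Bd isT.
  move=> b; rewrite !inE => /orP[]/eqP ->; first by rewrite K3.
  by rewrite fr3 // fr2 // fr1.
have [|t5 x5 l5] := @exec_compile phase5 m4 Bd isT.
  have sb : {subset bounds phase5 <= [:: 0; vK; vN]} by apply/allP.
  move=> b /sb; rewrite !inE => /or3P[]/eqP ->; split=> //.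
  - by rewrite z // fr1.
  - by rewrite fr4 // K3.
  - by rewrite N4.
exists (t1 + (u2 + (t3 + (t4 + t5).+1).+1).+1).+1, (den phase5 m4), F, B; split.
- apply: ExecSeq x1 _; apply: ExecSeq x2 _; apply: ExecSeq x3 _; exact: ExecSeq x4 x5.
- have sum p p' a b : a <= time p Bd -> b <= time p' Bd ->
      (a + b).+1 <= time (PSeq p p') Bd by move=> ap bp; rewrite /= ltnS leq_add.
  exact: sum l1 (sum _ _ _ _ l2 (sum _ _ _ _ l3 (sum _ _ _ _ l4 l5))).
- by split.
Qed.

End Correctness.

(** * Ratio and running time *)

Lemma approximation_ratio n (G : sgraph 'I_n) num dnm rr q h (F B : {set 'I_n}) :
  dnm <= num -> parameters n num dnm rr q h ->
  maximal_acyc G F -> #|~: F| <= #|~: B| ->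
  (forall D, acyc G D -> #|D| <= 4 * h -> explored G F #|~: B| D) ->
  mmfvs G * dnm <= #|~: B| * num.
Proof.
move=> dn [[hrr _] rrn [_ qrr] rrq [hn hK _]] [aF _] FB ex.
set V := #|~: B| in FB ex *.
suff H S : minimal_fvs G S -> #|S| <= V \/ #|S| <= rr * V.
  have : mmfvs G <= V \/ mmfvs G <= rr * V.
    have [rr0|rr1] : rr = 0 \/ 1 <= rr by lia.
      by left; apply/bigmax_leqP => S /asboolP/H[]//; rewrite rr0; lia.
    by right; apply/bigmax_leqP => S /asboolP/H[]; nia.
  by case; nia.
move=> mS; have Sn : #|S| <= n by apply: leq_trans (max_card S) _; rewrite card_ord.
(* If the complement of [F] has at least n / rr vertices, then [rr * V >= n], which exceeds or
   equals any solution. *)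
have [|lt] := leqP n (#|~: F| * rr); first by right; nia.
have [q0|q1] := posnP q.
  left; apply: (exact_approximation mS); apply: ex; first by have [] := (minimal_fvsP G S).1 mS.
  (* For q = 0 all sets are tried, among them the complement of [S]. *)
  have -> : 4 * h = 4 * n by case: hK => [->//|]; rewrite q0 mul0n muln0 => ?; lia.
  by apply: leq_trans (max_card _) _; rewrite card_ord; lia.
right; have Fn : #|~: F| <= n by apply: leq_trans (max_card _) _; rewrite card_ord.
(* Cancel rr in [#|~: F| * rr < n <= h * q * rr]; if h = n, use q >= 1. *)
have Fhq : #|~: F| <= h * q by case: hK => [->|]; nia.
have := approximation aF FB mS Fhq ex; nia.
Qed.

Import Order.TTheory GRing.Theory Num.Theory.
Local Open Scope ring_scope.

(** Real powers are avoided by comparing squares, as y^2 = x^3. The constant 49 is generous for all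
    cases together. *)
Lemma exponent_bound (R : realType) n rr q h num dnm (x : R) :
  parameters n num dnm rr q h -> 1 <= x -> x * dnm%:R = num%:R -> (0 < dnm)%N ->
  h%:R <= 49 * Num.max 1 (n%:R / x `^ (3 / 2)).
Proof.
move=> [[hrr hrr'] rrn [qn qrr] rrq [hn _ hm]] x1 xd d0.
have x0 : 0 < x by lra.
have dR : 0 < dnm%:R :> R by rewrite ltr0n.
set y := x `^ (3 / 2).
have y0 : 0 < y by rewrite powR_gt0.
have y2 : y ^+ 2 = x ^+ 3.
  rewrite -(powR_mulrn 2) ?ltW // /y -powRrM -(powR_mulrn 3) ?ltW //.
  by congr (_ `^ _); lra.
have max1 : 1 <= Num.max 1 (n%:R / y) by rewrite le_max lexx.
have max2 : n%:R / y <= Num.max 1 (n%:R / y) by rewrite le_max lexx orbT.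
have [h1|h1] := leqP h 1.
  have h1R : h%:R <= 1 :> R by rewrite lern1.
  lra.
(* For h >= 2, h <= 2 (h - 1) turns [h.-1 * (q * rr) < n] into this bound. *)
have hm1 : (h * (q * rr) < 2 * n)%N by case: hm => [?|]; nia.
have xrr : rr = n \/ x < rr%:R + 1.
  case: hrr' => [->|lt]; [by left|right].
  by rewrite -(ltr_pM2r dR) xd natr1 -natrM ltr_nat.
suff [hc|hc] : (h <= 49)%N \/ h%:R <= 49 * (n%:R / y).
- have : h%:R <= 49 :> R by rewrite ler_nat.
  lra.
- lra.
have [q0|q1] := posnP q.
  have rr7 : (rr < 7)%N by move: rrq; rewrite q0.
  case: xrr => [e|xr]; first by left; lia.
  right; have x7 : x <= 7.
    have : rr%:R + 1 <= 7 :> R by rewrite natr1 ler_nat.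
    lra.
  (* y^2 = x^3 <= 343, well below 49^2. *)
  have y49 : y <= 49.
    rewrite -(@ler_pXn2r _ 2) ?nnegrE ?(ltW y0) // y2.
    have : x ^+ 3 <= 7 ^+ 3 by apply: lerXn2r; rewrite ?nnegrE; lra.
    by lra.
  have hnR : h%:R <= n%:R :> R by rewrite ler_nat.
  have : n%:R <= 49 * (n%:R / y).
    rewrite mulrA ler_pdivlMr // mulrC ler_wpM2r //.
  lra.
(* If rr = n, then q >= 1 and h >= 2 contradict [hm1]. *)
case: xrr => [e|xr].
  have : (2 * n <= h * (q * rr))%N by rewrite e leq_mul // leq_pmull.
  by move=> hge; exfalso; lia.
right.
have rr1 : (1 <= rr)%N by nia.
have xr2 : x <= 2 * rr%:R.
  have : rr%:R + 1 <= 2 * rr%:R :> R by rewrite natr1 -natrM ler_nat; lia.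
  lra.
(* From rr < 7 (q + 1)^2 <= 28 q^2 one gets 8 rr <= 225 q^2, so x^3 <= 8 rr^3 <= (15 q rr)^2. With
   [hm1] this yields h y <= 30 n. *)
have yq : y <= 15 * (q * rr)%:R.
  have p15 : 0 <= 15 * (q * rr)%:R :> R by rewrite mulr_ge0.
  rewrite -(@ler_pXn2r _ 2) ?nnegrE ?(ltW y0) // y2.
  have : x ^+ 3 <= (2 * rr%:R) ^+ 3 by apply: lerXn2r; rewrite ?nnegrE; lra.
  have : (2 * rr%:R) ^+ 3 <= (15 * (q * rr)%:R) ^+ 2 :> R.
    have rr28 : (8 * rr <= 225 * (q * q))%N by nia.
    have := leq_mul rr28 (leqnn (rr * rr)%N).
    by rewrite -!natrM -!natrX ler_nat !expnS !expn0; lia.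
  by move=> hB hA; apply: le_trans hA hB.
have hR : h%:R * (q * rr)%:R <= 2 * n%:R :> R by rewrite -!natrM ler_nat ltnW.
rewrite mulrA ler_pdivlMr //.
have h0 : 0 <= h%:R :> R by [].
have : h%:R * y <= h%:R * (15 * (q * rr)%:R) by rewrite ler_wpM2l.
have n0 : 0 <= n%:R :> R by [].
lra.
Qed.

(** The 400 is 2 * 200: n + 2 is at most the square of the base, and 4h + 4 <= (4 * 49 + 4) e, where
    e is the maximum in the exponent. *)
Lemma time_bound_ge (R : realType) n h k t (x : R) :
  h%:R <= 49 * Num.max 1 (n%:R / x `^ (3 / 2)) ->
  (t <= ((n + 2) ^ (4 * h + 3) + 2) ^ k)%N ->
  t%:R <= time_bound (400 * k%:R) n x.
Proof.
set e := Num.max _ _ => he ht.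
have e1 : 1 <= e by rewrite /e le_max lexx.
set b := maxn n 2; have b2 : (2 <= b)%N by rewrite leq_maxr.
have nb : (n + 2 <= b ^ 2)%N.
  by have := leq_maxl n 2; rewrite -/b !expnS expn0; nia.
have tb : (t <= b ^ (2 * (4 * h + 4) * k))%N.
  apply: (leq_trans ht); rewrite expnM; case: k {ht} => // k; rewrite leq_exp2r //.
  rewrite expnM; apply: (@leq_trans ((n + 2) ^ (4 * h + 4))); last by rewrite leq_exp2r // addn4.
  rewrite [(4 * h + 4)%N]addnS expnS.
  have : (2 <= (n + 2) ^ (4 * h + 3))%N.
    rewrite addn3 expnS; have : (0 < (n + 2) ^ (4 * h).+2)%N by rewrite expn_gt0 addn2.
    nia.
  nia.
rewrite /time_bound -/e -/b.
apply: (@le_trans _ _ (b%:R ^+ (2 * (4 * h + 4) * k)%N)); first by rewrite -natrX ler_nat.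
rewrite -powR_mulrn //; apply: ler_powR; first by rewrite ler1n ltnW.
have k0 : 0 <= k%:R :> R by [].
have : (4 * h%:R + 4) * k%:R <= 200 * e * k%:R.
  by rewrite ler_wpM2r //; lra.
lra.
Qed.

Theorem theorem12 (R : realType) :
  exists (P : com) (c : R),
    forall (n : nat) (G : sgraph 'I_n) (r : rat), 1 <= r ->
      exists (t : nat) (m : memory),
        [/\ exec P (input G r) t m,
            minimal_fvs G (output n m),
            (mmfvs G)%:R / ratr r <= #|output n m|%:R :> R
          & t%:R <= time_bound c n (ratr r)].
Proof.
have [k tk] := time_poly (PSeq phase1 (PSeq step_size (PSeq part_size (PSeq code_bound phase5)))).
exists algorithm, (400 * k%:R) => n G r r1.
have [rr [q [h [par [t [m [F [B [ex tt [xF xB FB expl out]]]]]]]]]] := algorithmE G r.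
have nr : 0 <= numq r by rewrite numq_ge0; lra.
have d0 : (0 < absz (denq r))%N by rewrite absz_gt0 denq_neq0.
have xd : ratr r * (absz (denq r))%:R = (absz (numq r))%:R :> R.
  rewrite /ratr !natr_absz ger0_norm // ger0_norm ?denq_ge0 //.
  by rewrite divfK // intr_eq0 denq_neq0.
have x1 : 1 <= ratr r :> R by rewrite -[X in X <= _](rmorph1 (@ratr R)) ler_rat.
have dR : 0 < (absz (denq r))%:R :> R by rewrite ltr0n.
have dn : (absz (denq r) <= absz (numq r))%N.
  by rewrite -(ler_nat R) -xd ler_peMl // ltW.
exists t, m; rewrite out; split=> //.
- apply/minimal_fvsP; rewrite setCK; case: xB => aB mB; split=> // v.
  by rewrite inE; apply: mB.
- have x0 : 0 < ratr r :> R by lra.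
  rewrite ler_pdivrMr // -(ler_pM2r dR) -mulrA xd -!natrM ler_nat.
  exact: approximation_ratio par xF FB expl.
- apply: time_bound_ge (exponent_bound par x1 xd d0) _.
  exact: leq_trans tt (tk _).
Qed.
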